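(* Let $(R,\mathfrak{m})$ be an LC-finite regular local ring and let $I\supset J$ be ideals of $R$ with $\operatorname{depth}_J(R)\geq 2$. Suppose that each of $I$ and $J$ is generated by a part of a regular system of parameters of $R$. Then, for any $i\geq 1$, \[\operatorname{Ass} H_I^i(J)\text{ is finite}\iff \operatorname{Ass} H_I^{i-1}(R/J)\text{ is finite.}\]
   Context: All rings are commutative with identity. $H_I^i(M)$ denotes the $i$-th local cohomology module of $M$ with respect to $I$, and $\operatorname{Ass} M$ is the set of associated primes of $M$. A Noetherian ring $R$ is called LC-finite if $\operatorname{Ass} H_{\mathfrak a}^i(R)$ is finite for every ideal $\mathfrak a$ of $R$ and every $i\geq 0$. $\operatorname{depth}_J(R)$ is the length of a maximal $R$-sequence contained in $J$. A regular system of parameters of an $r$-dimensional regular local ring $(R,\mathfrak m)$ is a set of $r$ elements generating $\mathfrak m$. The notation $I\supset J$ means containment, not necessarily strict. *)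

(* Defs.v *)
From HB Require Import structures.
From mathcomp Require Import all_boot all_order all_algebra.
From mathcomp Require Import boolp classical_sets functions cardinality.

Set Implicit Arguments.
Unset Strict Implicit.
Unset Printing Implicit Defensive.

Import GRing.Theory Num.Theory.
Local Open Scope classical_set_scope.
Local Open Scope ring_scope.

Section Submodules.
Context {R : comNzRingType}.

Section MkSubmodule.
Variables (M : lmodType R) (P : set M).
Hypotheses (P0 : P 0) (PD : forall x y, P x -> P y -> P (x + y)).
Hypothesis PZ : forall a x, P x -> P (a *: x).

Lemma mk_submod_closed : GRing.subsemimod_closed [pred x | `[< P x >]].
Proof.
split; first by split=> [|x y /asboolP Px /asboolP Py]; apply/asboolP; auto.
by move=> a x /asboolP Px; apply/asboolP; auto.
Qed.

Definition mk_submod : submodClosed M :=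
  HB.pack (fun x : M => `[< P x >])
    (GRing.isSubSemiModClosed.Build R M _ mk_submod_closed).

Lemma mk_submodP x : reflect (P x) (x \in mk_submod).
Proof. exact: asboolP. Qed.

End MkSubmodule.

Definition submod (M : lmodType R) (N : submodClosed M) : Type :=
  {x : M | x \in N}.

HB.instance Definition _ (M : lmodType R) (N : submodClosed M) :=
  SubChoice.on (submod N).
HB.instance Definition _ (M : lmodType R) (N : submodClosed M) :=
  [SubChoice_isSubLmodule of submod N by <:].

Definition submod_zmodClosed (M : lmodType R) (N : submodClosed M) :
    zmodClosed M :=
  HB.pack (fun x : M => x \in N)
    (GRing.isZmodClosed.Build M _ (GRing.submod_closedB (submodClosedP N))).

Definition quotmod (M : lmodType R) (N : submodClosed M) : Type :=
  Quotient.quot (submod_zmodClosed N).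

Section QuotientModule.
Variables (M : lmodType R) (N : submodClosed M).

HB.instance Definition _ := GRing.Zmodule.on (quotmod N).

Definition quotmod_pi (x : M) : quotmod N := \pi_(Quotient.quot (submod_zmodClosed N))%qT x.

Lemma quotmod_pi_eq x y : (quotmod_pi x = quotmod_pi y) <-> x - y \in N.
Proof.
have E : (x - y \in N) = (quotmod_pi x == quotmod_pi y).
  exact: (Quotient.idealrBE (submod_zmodClosed N)).
by rewrite E; split=> /eqP.
Qed.

Lemma quotmod_pi_surj (q : quotmod N) : exists x, quotmod_pi x = q.
Proof. by exists (repr q); rewrite /quotmod_pi reprK. Qed.

Definition quotmod_scale (a : R) (q : quotmod N) : quotmod N :=
  quotmod_pi (a *: repr q).

Lemma quotmod_scale_pi a x :
  quotmod_scale a (quotmod_pi x) = quotmod_pi (a *: x).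
Proof.
apply/quotmod_pi_eq; rewrite -scalerBr; apply: rpredZ.
by apply/quotmod_pi_eq; rewrite {1}/quotmod_pi reprK.
Qed.

Lemma quotmod_piD x y : quotmod_pi (x + y) = quotmod_pi x + quotmod_pi y.
Proof. by rewrite /quotmod_pi (raddfD (\pi_(Quotient.quot (submod_zmodClosed N))%qT)). Qed.

Lemma quotmod_scaleA a b q :
  quotmod_scale a (quotmod_scale b q) = quotmod_scale (a * b) q.
Proof.
by have [x <-] := quotmod_pi_surj q; rewrite !quotmod_scale_pi scalerA.
Qed.

Lemma quotmod_scale1 : left_id 1 quotmod_scale.
Proof.
by move=> q; have [x <-] := quotmod_pi_surj q; rewrite quotmod_scale_pi scale1r.
Qed.

Lemma quotmod_scaleDr : right_distributive quotmod_scale +%R.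
Proof.
move=> a p q; have [x <-] := quotmod_pi_surj p; have [y <-] := quotmod_pi_surj q.
by rewrite -quotmod_piD !quotmod_scale_pi scalerDr quotmod_piD.
Qed.

Lemma quotmod_scaleDl q : {morph quotmod_scale^~ q : a b / a + b}.
Proof.
move=> a b; have [x <-] := quotmod_pi_surj q.
by rewrite !quotmod_scale_pi scalerDl quotmod_piD.
Qed.

HB.instance Definition _ := GRing.Zmodule_isLmodule.Build R (quotmod N)
  quotmod_scaleA quotmod_scale1 quotmod_scaleDr quotmod_scaleDl.

Lemma quotmod_pi_linear : linear quotmod_pi.
Proof. by move=> a x y; rewrite quotmod_piD -quotmod_scale_pi. Qed.

HB.instance Definition _ :=
  GRing.isLinear.Build R M (quotmod N) _ quotmod_pi quotmod_pi_linear.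

End QuotientModule.

Lemma ker0 (U V : lmodType R) (f : {linear U -> V}) : f 0 = 0.
Proof. exact: linear0. Qed.

Lemma kerD (U V : lmodType R) (f : {linear U -> V}) x y :
  f x = 0 -> f y = 0 -> f (x + y) = 0.
Proof. by move=> fx fy; rewrite linearD fx fy addr0. Qed.

Lemma kerZ (U V : lmodType R) (f : {linear U -> V}) a x :
  f x = 0 -> f (a *: x) = 0.
Proof. by move=> fx; rewrite linearZ_LR fx scaler0. Qed.

Definition ker (U V : lmodType R) (f : {linear U -> V}) : submodClosed U :=
  mk_submod (P := [set x | f x = 0]) (ker0 f) (@kerD _ _ f) (@kerZ _ _ f).

Lemma im0 (U V : lmodType R) (f : {linear U -> V}) : range f 0.
Proof. by exists 0; rewrite ?linear0. Qed.

Lemma imD (U V : lmodType R) (f : {linear U -> V}) y z :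
  range f y -> range f z -> range f (y + z).
Proof. by case=> u _ <- [v _ <-]; exists (u + v); rewrite ?linearD. Qed.

Lemma imZ (U V : lmodType R) (f : {linear U -> V}) a y :
  range f y -> range f (a *: y).
Proof. by case=> u _ <-; exists (a *: u); rewrite ?linearZ_LR. Qed.

Definition im (U V : lmodType R) (f : {linear U -> V}) : submodClosed V :=
  mk_submod (P := range f) (im0 f) (@imD _ _ f) (@imZ _ _ f).

Section Preimage.
Variables (U V : lmodType R) (f : {linear U -> V}) (N : submodClosed V).

Lemma preim0 : f 0 \in N. Proof. by rewrite linear0 rpred0. Qed.

Lemma preimD x y : f x \in N -> f y \in N -> f (x + y) \in N.
Proof. by move=> fx fy; rewrite linearD rpredD. Qed.

Lemma preimZ a x : f x \in N -> f (a *: x) \in N.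
Proof. by move=> fx; rewrite linearZ_LR rpredZ. Qed.

Definition preim : submodClosed U :=
  mk_submod (P := [set x | f x \in N]) preim0 preimD preimZ.

End Preimage.

(* [ker g] modulo the part of [im f] lying in it; for a complex this is the
   usual [ker g / im f] *)
Definition cohomology (U V W : lmodType R)
    (f : {linear U -> V}) (g : {linear V -> W}) : lmodType R :=
  quotmod (preim (\val : {linear submod (ker g) -> V}) (im f)).

End Submodules.

Notation ideal R := (submodClosed (R : comNzRingType)^o).

Section Torsion.
Context {R : comNzRingType}.
Implicit Types (I : ideal R) (M N : lmodType R).

Section GeneratedIdeal.
Variable S : set R.

Definition in_gen (x : R) : Prop :=
  forall K : ideal R, (forall s, S s -> s \in K) -> x \in K.

Lemma gen0 : in_gen 0. Proof. by move=> K _; exact: rpred0. Qed.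

Lemma genD x y : in_gen x -> in_gen y -> in_gen (x + y).
Proof. by move=> gx gy K SK; apply: rpredD; [exact: gx | exact: gy]. Qed.

Lemma genZ (a : R) (x : R^o) : in_gen x -> in_gen (a *: x).
Proof. by move=> gx K SK; apply: rpredZ; exact: gx. Qed.

Definition gen : ideal R :=
  mk_submod (M := R^o) (P := in_gen) gen0 genD genZ.

Lemma genP x : reflect (in_gen x) (x \in gen).
Proof. exact: asboolP. Qed.

Lemma mem_gen s : S s -> s \in gen.
Proof. by move=> Ss; apply/genP => K; apply. Qed.

Lemma gen_min (K : ideal R) : (forall s, S s -> s \in K) ->
  {subset gen <= K}.
Proof. by move=> SK x /genP; apply. Qed.

End GeneratedIdeal.

Definition ideal_pow I (n : nat) : ideal R :=
  gen [set x | exists2 f : 'I_n -> R,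
    (forall j, f j \in I) & x = \prod_j f j].

Lemma ideal_powD I n k : {subset ideal_pow I (n + k) <= ideal_pow I n}.
Proof.
apply: gen_min => _ [f fI ->]; rewrite big_split_ord /= mulrC.
apply: (@rpredZ R R^o (ideal_pow I n)); apply: mem_gen.
by exists (fun j => f (lshift k j)).
Qed.

Section TorsionSubmodule.
Variables (I : ideal R) (M : lmodType R).

Definition is_torsion (x : M) : Prop :=
  exists n, forall r : R, r \in ideal_pow I n -> r *: x = 0.

Lemma torsion0 : is_torsion 0.
Proof. by exists 0; move=> r _; rewrite scaler0. Qed.

Lemma torsionD x y : is_torsion x -> is_torsion y -> is_torsion (x + y).
Proof.
move=> [n xn] [k yk]; exists (n + k)%N => r Ir.
rewrite scalerDr xn ?yk ?addr0 //; last exact: ideal_powD Ir.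
by apply: (@ideal_powD I k n); rewrite addnC.
Qed.

Lemma torsionZ a x : is_torsion x -> is_torsion (a *: x).
Proof.
by move=> [n xn]; exists n => r Ir; rewrite scalerA mulrC -scalerA xn ?scaler0.
Qed.

Definition torsion : submodClosed M := mk_submod torsion0 torsionD torsionZ.

Lemma torsionP x : reflect (is_torsion x) (x \in torsion).
Proof. exact: asboolP. Qed.

End TorsionSubmodule.

Definition Gamma I M : lmodType R := submod (torsion I M).

Section TorsionMap.
Variables (I : ideal R) (M N : lmodType R) (f : {linear M -> N}).

Lemma torsion_map_subproof (x : Gamma I M) : f (\val x) \in torsion I N.
Proof.
have /torsionP[n xn] := valP x; apply/torsionP; exists n => r Ir /=.
by rewrite -linearZ_LR xn ?linear0.
Qed.

Definition Gamma_fun (x : Gamma I M) : Gamma I N :=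
  exist _ (f (\val x)) (torsion_map_subproof x).

Lemma Gamma_fun_linear : linear Gamma_fun.
Proof. by move=> a x y; apply: val_inj; rewrite /= !linearP. Qed.

HB.instance Definition _ :=
  GRing.isLinear.Build R (Gamma I M) (Gamma I N) _ Gamma_fun Gamma_fun_linear.

Definition Gamma_map : {linear Gamma I M -> Gamma I N} := Gamma_fun.

End TorsionMap.

End Torsion.

Section InjectiveResolutions.
Context {R : comNzRingType}.

Definition injective_module (E : lmodType R) : Prop :=
  forall (A B : lmodType R) (f : {linear A -> B}) (g : {linear A -> E}),
    injective f -> exists h : {linear B -> E}, forall a, h (f a) = g a.

Record inj_resolution (M : lmodType R) := InjResolution {
  res_mod : nat -> lmodType R;
  res_aug : {linear M -> res_mod 0};
  res_d : forall n, {linear res_mod n -> res_mod n.+1};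
  res_injective : forall n, injective_module (res_mod n);
  res_aug_inj : injective res_aug;
  res_exact0 : range res_aug = [set x | res_d 0 x = 0];
  res_exactS : forall n, range (res_d n) = [set x | res_d n.+1 x = 0]
}.

Definition derived_Gamma (I : ideal R) (M : lmodType R) (E : inj_resolution M)
    (i : nat) : lmodType R :=
  match i with
  | 0 => cohomology (\0 : {linear Gamma I (res_mod E 0) -> Gamma I (res_mod E 0)})
           (Gamma_map I (res_d E 0))
  | j.+1 => cohomology (Gamma_map I (res_d E j)) (Gamma_map I (res_d E j.+1))
  end.

End InjectiveResolutions.

Section Divisible.

Definition divisible (D : zmodType) : Prop :=
  forall (n : nat) (d : D), (0 < n)%N -> exists e, e *+ n = d.

Section Extension.
Variables (B D : zmodType) (divD : divisible D).
Implicit Types G : set (B * D).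

Definition partial_hom G : Prop :=
  [/\ G 0, forall x y, G x -> G y -> G (x - y) & forall d, G (0, d) -> d = 0].

Lemma partial_hom_mulrz G x (k : int) : partial_hom G -> G x -> G (x *~ k).
Proof.
move=> [G0 GB _] Gx.
have GN y : G y -> G (- y) by move=> Gy; rewrite -[- y]add0r; exact: GB.
have GD y z : G y -> G z -> G (y + z).
  by move=> Gy Gz; rewrite -[z]opprK; apply/GB/GN.
have Gn n : G (x *+ n) by elim: n => [|n IH]; rewrite ?mulr0n ?mulrS; auto.
by case: k => n /=; [exact: Gn | rewrite NegzE mulrNz; exact/GN/Gn].
Qed.

Lemma partial_hom_fun G b d d' :
  partial_hom G -> G (b, d) -> G (b, d') -> d = d'.
Proof.
move=> [_ GB Gf] Gd Gd'; apply/eqP; rewrite -subr_eq0; apply/eqP/Gf.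
by rewrite -(subrr b); exact: (GB _ _ Gd Gd').
Qed.

Lemma partial_hom_value G (b : B) : partial_hom G ->
  exists d : D, forall (k : int) v, G (b *~ k, v) -> v = d *~ k.
Proof.
move=> hG; have [G0 GB Gf] := hG.
have subE x y u v : G (x, u) -> G (y, v) -> G (x - y, u - v).
  exact: GB.
have mulE x u (k : int) : G (x, u) -> G (x *~ k, u *~ k).
  move=> /(partial_hom_mulrz k hG).
  suff -> : (x, u) *~ k = (x *~ k, u *~ k) by [].
  have E n : (x, u) *+ n = (x *+ n, u *+ n).
    by elim: n => [|n IH]; rewrite ?mulr0n // !mulrS IH.
  by case: k => n; rewrite ?NegzE ?mulrNz -!pmulrn E.
pose P n := `[< (0 < n)%N /\ exists v, G (b *~ n%:Z, v) >].
have [[n0 Pn0]|noP] := pselect (exists n, P n); last first.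
  exists 0 => k v Gv; rewrite mul0rz; apply: Gf.
  suff k0 : k = 0 by rewrite k0 mulr0z in Gv.
  apply: contrapT => /eqP k0; apply: noP; exists `|k|%N; apply/asboolP.
  split; first by rewrite absz_gt0.
  rewrite abszE; case: (ger0P k) => _; first by exists v.
  by exists (v *~ -1); rewrite -(mulrN1 k) mulrzA; exact: mulE.
have exP : exists n, P n by exists n0.
case: (ex_minnP exP) => n /asboolP[n_gt0 [w Gw]] nmin.
have [d dw] := divD w n_gt0; exists d => k v Gv.
have := divz_eq k n%:Z; set q := (k %/ n)%Z => kE.
have Gr : G (b *~ (k %% n)%Z, v - w *~ q).
  have -> : (k %% n)%Z = k - n%:Z * q by apply/eqP; rewrite eq_sym subr_eq addrC mulrC -kE.
  by rewrite mulrzBr mulrzA; apply: subE => //; exact: mulE.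
have n_neq0 : n%:Z != 0 by rewrite eqz_nat -lt0n.
have r0 : (k %% n)%Z = 0.
  apply: contrapT => /eqP rn0.
  have r_ge0 := modz_ge0 k n_neq0.
  have : (n <= `|(k %% n)%Z|)%N.
    apply: nmin; apply/asboolP; split; first by rewrite absz_gt0.
    by exists (v - w *~ q); rewrite gez0_abs.
  by rewrite leqNgt -ltz_nat gez0_abs // ltz_pmod.
move: Gr; rewrite r0 mulr0z => /Gf /eqP; rewrite subr_eq0 => /eqP ->.
by rewrite kE r0 addr0 mulrC mulrzA -dw pmulrn.
Qed.

Lemma additive_extension G : partial_hom G ->
  exists f : {additive B -> D}, forall b d, G (b, d) -> f b = d.
Proof.
move=> hG; pose P : set (set (B * D)) := [set H | partial_hom (G `|` H)].
have [H [PH Hmax]] : exists H, P H /\ forall H', H `<` H' -> ~ P H'.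
  apply: Zorn_bigcup => F FP totF; rewrite /P /=.
  have [[H0 FH0]|F0] := pselect (exists H, F H); last first.
    suff -> : \bigcup_(X in F) X = set0 by rewrite setU0.
    by rewrite -subset0 => x [X FX]; case: F0; exists X.
  have cov x : (G `|` \bigcup_(X in F) X) x -> exists2 X, F X & (G `|` X) x.
    by case=> [Gx|[X FX Xx]]; [exists H0 | exists X] => //; [left|right].
  split; first by left; case: hG.
    move=> x y /cov[X FX Xx] /cov[Y FY Yy].
    have [Z FZ [Zx Zy]] : exists2 Z, F Z & (G `|` Z) x /\ (G `|` Z) y.
      have [XY|YX] := totF X Y FX FY.
        by exists Y => //; split=> //; case: Xx; [left|move=> /XY; right].
      by exists X => //; split=> //; case: Yy; [left|move=> /YX; right].
    have [_ ZB _] := FP _ FZ.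
    by case: (ZB _ _ Zx Zy); [left|right; exists Z].
  by move=> d /cov[X FX Xd]; have [_ _] := FP _ FX; exact.
pose K := G `|` H; have hK : partial_hom K := PH.
have totK b : exists d, K (b, d).
  have [d0 d0E] := partial_hom_value b hK.
  pose K' : set (B * D) := [set x | exists k : int, K (x.1 - b *~ k, x.2 - d0 *~ k)].
  have [K0 KB Kf] := hK.
  have KK' : K `<=` K'.
    by move=> [x u] Kxu; exists 0; rewrite /= !mulr0z !subr0.
  have hK' : partial_hom K'.
    split; first exact: KK'.
      move=> [x u] [y v] [k Kk] [l Kl]; exists (k - l) => /=.
      have E (V : zmodType) (p q r : V) : p - q *~ k - (r - q *~ l) = p - r - q *~ (k - l).
        by rewrite mulrzBr opprB opprB addrACA [RHS]addrACA [- r + _]addrC.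
      by rewrite -!E; exact: (KB _ _ Kk Kl).
    move=> d [k] /=; rewrite sub0r -mulrNz => /d0E.
    by rewrite mulrNz => /eqP; rewrite -subr_eq0 opprK subrK => /eqP.
  have K'K : K' `<=` K.
    apply: contrapT => nK'K; apply: (Hmax K').
      split; first by move=> x Hx; apply: KK'; right.
      by move=> K'H; apply: nK'K => x /K'H; right.
    rewrite /P /= (_ : G `|` K' = K') //; apply/seteqP; split=> x; last by right.
    by case=> // Gx; apply: KK'; left.
  by exists d0; apply: K'K; exists 1; rewrite /= !mulr1z !subrr.
pose f b := projT1 (cid (totK b)).
have fK b : K (b, f b) by exact: projT2 (cid (totK b)).
have [_ KB _] := hK.
have f_zmod : zmod_morphism f.
  move=> x y; apply: (partial_hom_fun hK (fK _)).
  exact: (KB _ _ (fK x) (fK y)).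
pose F : {additive B -> D} :=
  HB.pack f (GRing.isZmodMorphism.Build B D f f_zmod).
by exists F => b d Gbd; apply: (partial_hom_fun hK (fK b)); left.
Qed.

End Extension.
End Divisible.

Section RationalsModIntegers.

Definition rat_int : pred rat := fun x => x \is a Num.int.

Lemma rat_int_closed : zmod_closed rat_int.
Proof.
split; rewrite /rat_int; first by rewrite unfold_in; exact: rpred0.
by move=> x y; rewrite !unfold_in => Zx Zy; exact: rpredB.
Qed.

Definition rat_intZ : zmodClosed rat :=
  HB.pack rat_int (GRing.isZmodClosed.Build rat rat_int rat_int_closed).

Definition QZ : zmodType := Quotient.quot rat_intZ.

Definition QZ_pi : {additive rat -> QZ} :=
  \pi_(Quotient.quot rat_intZ)%qT : {additive rat -> Quotient.quot rat_intZ}.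

Lemma QZ_pi_eq0 x : (QZ_pi x == 0) = (x \is a Num.int).
Proof.
rewrite -(raddf0 QZ_pi) /QZ_pi /= -[LHS](Quotient.idealrBE rat_intZ).
by rewrite subr0.
Qed.

Lemma divisible_QZ : divisible QZ.
Proof.
move=> n d n_gt0; exists (QZ_pi (repr d / n%:R)).
rewrite -raddfMn -[_ / _ *+ n]mulr_natr divfK ?pnatr_eq0 -?lt0n //.
exact: reprK.
Qed.

Lemma QZ_cogenerator (M : zmodType) (m : M) : m != 0 ->
  exists f : {additive M -> QZ}, f m != 0.
Proof.
move=> m0.
have inv_nint n : (1 < n)%N -> QZ_pi (n%:R^-1) != 0.
  move=> n1; rewrite QZ_pi_eq0; apply/negP => /intrP[z zE].
  have n0 : n%:R != 0 :> rat by rewrite pnatr_eq0 -lt0n (ltn_trans _ n1).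
  have : (z * n%:Z)%:~R = 1 :> rat by rewrite intrM -zE mulVf.
  rewrite -[1]/(1%:~R) => /intr_inj zn1.
  have : (n%:Z %| 1)%Z by apply/dvdzP; exists z.
  by rewrite dvdz1 /= => /eqP nE; rewrite nE in n1.
have [d d0 dE] : exists2 d : QZ, d != 0 &
    forall k : int, m *~ k = 0 -> d *~ k = 0.
  pose P n := (0 < n)%N && (m *+ n == 0).
  have [[n0 Pn0]|noP] := pselect (exists n, P n); last first.
    exists (QZ_pi 2%:R^-1); first exact: inv_nint.
    move=> k mk; suff -> : k = 0 by rewrite mulr0z.
    apply: contrapT => /eqP k0; apply: noP; exists `|k|%N.
    rewrite /P absz_gt0 k0 /= -[_ *+ _]/(m *~ `|k|%N) abszE.
    by case: (ger0P k) => _; rewrite ?mulrNz mk ?oppr0.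
  have exP : exists n, P n by exists n0.
  case: (ex_minnP exP) => n /andP[n_gt0 /eqP mn] nmin.
  have n1 : (1 < n)%N.
    by case: n n_gt0 mn {nmin} => [|[|n]] //= _ /eqP; rewrite mulr1n (negPf m0).
  exists (QZ_pi n%:R^-1); first exact: inv_nint.
  move=> k mk; have n_neq0 : n%:Z != 0 by rewrite eqz_nat -lt0n.
  have r0 : (k %% n)%Z = 0.
    apply: contrapT => /eqP rn0; have r_ge0 := modz_ge0 k n_neq0.
    have : (n <= `|(k %% n)%Z|)%N.
      apply: nmin; rewrite /P absz_gt0 rn0 /= -[_ *+ _]/(m *~ `|(k %% n)%Z|%N).
      rewrite gez0_abs //.
      have -> : (k %% n)%Z = k - n%:Z * (k %/ n)%Z.
        by apply/eqP; rewrite eq_sym subr_eq addrC mulrC -divz_eq.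
      rewrite mulrzBr mk mulrzA.
      by rewrite -[m *~ n]/(m *+ n) mn mul0rz subrr.
    by rewrite leqNgt -ltz_nat gez0_abs // ltz_pmod.
  rewrite (divz_eq k n) r0 addr0 mulrC mulrzA -[_ *~ n%:Z]/(_ *+ n).
  rewrite -raddfMn -[n%:R^-1 *+ n]mulr_natr mulVf ?pnatr_eq0 -?lt0n //.
  have -> : QZ_pi 1 = 0 by apply/eqP; rewrite QZ_pi_eq0 rpred1.
  by rewrite mul0rz.
pose G : set (M * QZ) := [set x | exists k : int, x = (m *~ k, d *~ k)].
have hG : partial_hom G.
  split; first by exists 0; rewrite !mulr0z.
    by move=> _ _ [k ->] [l ->]; exists (k - l); rewrite !mulrzBr.
  by move=> e [k [/esym mk ->]]; exact: dE.
have [f fE] := additive_extension divisible_QZ hG.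
by exists f; rewrite (fE m d) //; exists 1; rewrite !mulr1z.
Qed.

End RationalsModIntegers.

Section Coinduced.
Variables (R : comNzRingType) (A : zmodType).

Lemma coind_closed :
  zmod_closed [pred f : R -> A | `[< zmod_morphism f >]].
Proof.
split; first by apply/asboolP => x y; rewrite subrr.
move=> f g /asboolP fA /asboolP gA; apply/asboolP => x y.
have E (h : R -> A) z : (f - g) z = f z - g z by [].
by rewrite !E // fA gA !opprB addrACA [RHS]addrACA [- f y - _]addrC.
Qed.

Definition coind_pred : zmodClosed (R -> A) :=
  HB.pack (fun f : R -> A => `[< zmod_morphism f >])
    (GRing.isZmodClosed.Build (R -> A) _ coind_closed).

(* [Hom_Z(R, A)] with [R] acting by [(a f) r = f (r a)] *)
Definition coind : Type := {f : R -> A | f \in coind_pred}.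

HB.instance Definition _ := SubChoice.on coind.
HB.instance Definition _ := [SubChoice_isSubZmodule of coind by <:].

Lemma coindB (f : coind) : zmod_morphism (val f).
Proof. by case: f => f /= /asboolP. Qed.

Lemma coindD (f : coind) x y : val f (x + y) = val f x + val f y.
Proof.
pose F : {additive R -> A} :=
  HB.pack (val f) (GRing.isZmodMorphism.Build R A (val f) (coindB f)).
exact: (raddfD F).
Qed.

Lemma coind_scale_subproof (a : R) (f : coind) :
  (fun r => val f (r * a)) \in coind_pred.
Proof. by apply/asboolP => x y; rewrite mulrBl coindB. Qed.

Definition coind_scale (a : R) (f : coind) : coind :=
  exist (fun f => f \in coind_pred) _ (coind_scale_subproof a f).

Lemma coind_scaleA a b f :
  coind_scale a (coind_scale b f) = coind_scale (a * b) f.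
Proof. by apply/val_inj/funext => r /=; rewrite mulrA. Qed.

Lemma coind_scale1 : left_id 1 coind_scale.
Proof. by move=> f; apply/val_inj/funext => r /=; rewrite mulr1. Qed.

Lemma coind_scaleDr : right_distributive coind_scale +%R.
Proof. by move=> a f g; apply/val_inj/funext. Qed.

Lemma coind_scaleDl f : {morph coind_scale^~ f : a b / a + b}.
Proof. by move=> a b; apply/val_inj/funext => r /=; rewrite mulrDr coindD. Qed.

HB.instance Definition _ := GRing.Zmodule_isLmodule.Build R coind
  coind_scaleA coind_scale1 coind_scaleDr coind_scaleDl.

Lemma injective_coind : divisible A -> injective_module coind.
Proof.
move=> divA X Y f g f_inj.
pose G : set (Y * A) := [set u | exists x, u = (f x, val (g x) 1)].
have hG : partial_hom G.
  split; first by exists 0; rewrite !linear0.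
    by move=> _ _ [x ->] [y ->]; exists (x - y); rewrite !linearB.
  move=> d [x [/esym fx ->]].
  by rewrite (f_inj x 0) ?linear0.
have [F FE] := additive_extension divA hG.
have FA y : (fun r : R => F (r *: y)) \in coind_pred.
  by apply/asboolP => r s; rewrite scalerBl raddfB.
pose h y : coind := exist (fun f => f \in coind_pred) _ (FA y).
have h_lin : linear h.
  move=> a x y; apply/val_inj/funext => r /=.
  by rewrite scalerDr raddfD scalerA.
pose hL : {linear Y -> coind} :=
  HB.pack h (GRing.isLinear.Build R Y coind _ h h_lin).
exists hL => x.
apply/val_inj/funext => r /=.
rewrite -linearZ_LR (FE _ (val (g (r *: x)) 1)); last by exists (r *: x).
by rewrite linearZ_LR /= mul1r.
Qed.

End Coinduced.

(* Every module embeds in the injective module [Hom_Z(R, (Q/Z)^X)], where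
   [X = Hom_Z(M, Q/Z)], by [m |-> (r |-> (f |-> f (r m)))]. *)
Section Envelope.
Variables (R : comNzRingType) (M : lmodType R).

Definition char_group : Type := {additive M -> QZ}.

Lemma divisible_fun (T : Type) (A : zmodType) :
  divisible A -> divisible (T -> A).
Proof.
move=> divA n f n_gt0.
have mulE (g : T -> A) k t : (g *+ k) t = g t *+ k.
  by elim: k => [|k IH]; rewrite ?mulr0n // !mulrS -IH.
exists (fun t => projT1 (cid (divA n (f t) n_gt0))); apply/funext => t.
by rewrite mulE; exact: projT2 (cid (divA n (f t) n_gt0)).
Qed.

Definition env : lmodType R := coind R (char_group -> QZ).

Lemma injective_env : injective_module env.
Proof. exact/injective_coind/divisible_fun/divisible_QZ. Qed.

Lemma env_map_subproof (m : M) :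
  (fun (r : R) (f : char_group) => f (r *: m)) \in coind_pred R (char_group -> QZ).
Proof.
apply/asboolP => r s; apply/funext => f.
by rewrite scalerBl raddfB.
Qed.

Definition env_fun (m : M) : env :=
  exist (fun f => f \in coind_pred R _) _ (env_map_subproof m).

Lemma env_fun_linear : linear env_fun.
Proof.
move=> a x y; apply/val_inj/funext => r; apply/funext => f /=.
by rewrite scalerDr raddfD scalerA.
Qed.

HB.instance Definition _ :=
  GRing.isLinear.Build R M env _ env_fun env_fun_linear.

Definition env_map : {linear M -> env} := env_fun.

Lemma env_map_inj : injective env_map.
Proof.
move=> x y xy; apply/eqP; rewrite -subr_eq0; apply: contrapT => /negP xy0.
have [f /eqP] := QZ_cogenerator xy0; apply.
have /(congr1 val)/(congr1 (fun F => F 1 f)) /= := xy.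
by rewrite !scale1r raddfB => ->; rewrite subrr.
Qed.

End Envelope.

Section StandardResolution.
Variables (R : comNzRingType) (M : lmodType R).

Fixpoint cosyzygy (n : nat) : lmodType R :=
  if n is k.+1 then quotmod (im (env_map (cosyzygy k))) else M.

Definition std_mod (n : nat) : lmodType R := env (cosyzygy n).

Definition std_pi (n : nat) : {linear std_mod n -> cosyzygy n.+1} :=
  @quotmod_pi R (std_mod n) (im (env_map (cosyzygy n))).

Definition std_d (n : nat) : {linear std_mod n -> std_mod n.+1} :=
  env_map (cosyzygy n.+1) \o std_pi n.

Lemma std_d_eq0 n x : (std_d n x = 0) <-> range (env_map (cosyzygy n)) x.
Proof.
have -> : (std_d n x = 0) <-> (std_pi n x = 0).
  split=> [|px]; last by rewrite /std_d /= -[_ _ x]/(std_pi n x) px linear0.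
  by move=> dx; apply: (@env_map_inj R (cosyzygy n.+1)); rewrite linear0.
rewrite -(linear0 (std_pi n)).
have := quotmod_pi_eq (im (env_map (cosyzygy n))) x 0.
rewrite subr0 => ->; split=> [/asboolP//|?]; exact/asboolP.
Qed.

Lemma std_exact0 : range (env_map M) = [set x | std_d 0 x = 0].
Proof. by apply/seteqP; split=> x; case: (@std_d_eq0 0 x). Qed.

Lemma std_exactS n : range (std_d n) = [set x | std_d n.+1 x = 0].
Proof.
apply/seteqP; split=> [_ [x _ <-]|y /(@std_d_eq0 n.+1 y)[q _ <-]].
  by apply/(@std_d_eq0 n.+1 _).2; exists (std_pi n x).
have [x xq] := quotmod_pi_surj q.
by exists x => //; rewrite -xq.
Qed.

Definition std_resolution : inj_resolution M :=
  InjResolution (fun n => @injective_env R (cosyzygy n)) (@env_map_inj R M)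
    std_exact0 std_exactS.

End StandardResolution.

Section CommutativeAlgebra.
Variable R : comNzRingType.
Implicit Types (I J P K m : ideal R) (s t : seq R) (M : lmodType R).

(* The right derived functor of [Gamma I], computed on a fixed
   choice of injective resolutions; any other one gives an isomorphic
   module. *)
Definition local_cohomology I (i : nat) M : lmodType R :=
  derived_Gamma I (std_resolution M) i.

Definition gen_seq s : ideal R := gen [set` s].

Definition prime_ideal P : Prop :=
  1 \notin P /\ forall x y : R, x * y \in P -> x \in P \/ y \in P.

Definition maximal_ideal P : Prop :=
  1 \notin P /\ forall K, {subset P <= K} -> 1 \notin K -> {subset K <= P}.

Lemma ann0 M (x : M) : (0 : R) *: x = 0. Proof. exact: scale0r. Qed.

Lemma annD M (x : M) (a b : R) :
  a *: x = 0 -> b *: x = 0 -> (a + b) *: x = 0.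
Proof. by move=> ax bx; rewrite scalerDl ax bx addr0. Qed.

Lemma annZ M (x : M) (c : R) (a : R^o) :
  (a : R) *: x = 0 -> (c *: a : R) *: x = 0.
Proof. by move=> ax; rewrite -scalerA ax scaler0. Qed.

Definition ann M (x : M) : ideal R :=
  mk_submod (M := R^o) (P := [set a | (a : R) *: x = 0])
    (ann0 x) (@annD M x) (@annZ M x).

(* Prime ideals are recorded by their underlying sets, so that extensionally
   equal ideals are identified when counting. *)
Definition Ass M : set (set R) :=
  [set [set` ann x] | x in [set x : M | prime_ideal (ann x)]].

Definition noetherian : Prop := forall I, exists s, I =i gen_seq s.

Definition LC_finite : Prop :=
  noetherian /\
  forall I (i : nat), finite_set (Ass (local_cohomology I i R^o)).

Definition local_ring m : Prop :=
  maximal_ideal m /\ forall K, maximal_ideal K -> K =i m.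

Definition prime_chain (n : nat) : Prop :=
  exists2 P : 'I_n.+1 -> ideal R, forall i, prime_ideal (P i) &
    forall i j : 'I_n.+1, (i < j)%N ->
      {subset P i <= P j} /\ ~ {subset P j <= P i}.

Definition krull_dim (n : nat) : Prop :=
  prime_chain n /\ forall k, prime_chain k -> (k <= n)%N.

Definition regular_system_of_parameters m s : Prop :=
  [/\ krull_dim (size s), uniq s & m =i gen_seq s].

Definition regular_local_ring m : Prop :=
  [/\ noetherian, local_ring m & exists s, regular_system_of_parameters m s].

Definition gen_by_part_of_rsop m I : Prop :=
  exists s t, [/\ regular_system_of_parameters m s, {subset t <= s} &
                   I =i gen_seq t].

Definition regular_sequence s : Prop :=
  (1 \notin gen_seq s) /\
  forall (k : nat) (y : R), (k < size s)%N ->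
    s`_k * y \in gen_seq (take k s) -> y \in gen_seq (take k s).

Definition maximal_regular_sequence_in J s : Prop :=
  [/\ regular_sequence s, {subset s <= J} &
      forall y, y \in J -> ~ regular_sequence (rcons s y)].

(* "depth_J(R) = n"; all maximal [R]-sequences in [J] have the same length when
   [R] is Noetherian and [J] is proper *)
Definition depth_in J (n : nat) : Prop :=
  exists2 s, maximal_regular_sequence_in J s & size s = n.

End CommutativeAlgebra.

(* Main.v *)
(** The long exact sequence of [0 -> J -> R -> R/J -> 0] breaks up into short
    exact sequences [0 -> H^(i-1)(R/J) -> H^i(J) -> H^i(R)] as soon as every
    map [H^j(R) -> H^j(R/J)] is zero; the set [Ass H^i(R)] being finite, the
    equivalence follows from the behaviour of [Ass] in exact sequences.

    Since [J <> 0], it contains a member [y] of a regular system of parameters,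
    and [y] can be exchanged for one of the [h] parameters generating [I].
    Parameters form a regular sequence with prime partial ideals (by Krull's
    principal ideal theorem), and if [K] is generated by [k] of the [h]
    parameters of [I], then [H^j(R/K)] vanishes for [j <> h - k]: for [k = h] because
    [R/I] is torsion and [Gamma] preserves injectives, and then by descending
    induction, multiplication by the next parameter being injective on the
    torsion module [H^j(R/K)].  Hence [H^j(R) = 0] for [j <> h], while
    [H^h(R/y) = 0] makes [H^h(R)] divisible by [y]; as [y] kills [H^h(R/J)], the
    map [H^h(R) -> H^h(R/J)] is zero. *)

Require Import Defs.
From HB Require Import structures.
From mathcomp Require Import all_boot all_order all_algebra.
From mathcomp Require Import boolp classical_sets functions cardinality.
From mathcomp Require Import ring.
Import GRing.Theory.
Local Open Scope classical_set_scope.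
Local Open Scope ring_scope.

Set Implicit Arguments.
Unset Strict Implicit.
Unset Printing Implicit Defensive.

(** * Ideals generated by adjoining elements to a base ideal *)

Section Ideals.
Context {R : comNzRingType}.
Implicit Types (K L P Q : ideal R) (l : seq R) (x y z a b : R).

Lemma idealM K a x : x \in K -> a * x \in K.
Proof. exact: (@rpredZ R R^o K a x). Qed.

Lemma idealD K x y : x \in K -> y \in K -> x + y \in K.
Proof. exact: (@rpredD R^o K x y). Qed.

Lemma idealN K x : x \in K -> - x \in K.
Proof. by move=> Kx; rewrite -mulN1r; exact: idealM. Qed.

Lemma idealB K x y : x \in K -> y \in K -> x - y \in K.
Proof. by move=> Kx Ky; apply/idealD/idealN. Qed.

Lemma ideal0 K : 0 \in K.
Proof. exact: (@rpred0 R^o K). Qed.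

Section MkIdeal.
Variable S : set R.
Hypotheses (S0 : S 0) (SD : forall x y, S x -> S y -> S (x + y)).
Hypothesis SM : forall a x, S x -> S (a * x).

Definition mk_ideal : ideal R := @mk_submod R R^o S S0 SD SM.

Lemma mk_idealP x : (x \in mk_ideal) <-> S x.
Proof. by split=> /(mk_submodP (M := R^o) S0 SD SM). Qed.

End MkIdeal.

Lemma ideal_of_set (S : set R) : S 0 -> (forall x y, S x -> S y -> S (x + y)) ->
  (forall a x, S x -> S (a * x)) -> exists K, forall x, (x \in K) <-> S x.
Proof. by move=> S0 SD SM; exists (mk_ideal S0 SD SM) => x; exact: mk_idealP. Qed.

Definition adj_set K x : set R :=
  [set r | exists2 k : R, k \in K & exists a : R, r = k + a * x].

Lemma adj0 K x : adj_set K x 0.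
Proof. by exists 0; rewrite ?ideal0 //; exists 0; ring. Qed.

Lemma adjD K x r s : adj_set K x r -> adj_set K x s -> adj_set K x (r + s).
Proof.
move=> [k Kk [a ->]] [k' Kk' [a' ->]]; exists (k + k'); first exact: idealD.
by exists (a + a'); ring.
Qed.

Lemma adjM K x c r : adj_set K x r -> adj_set K x (c * r).
Proof.
move=> [k Kk [a ->]]; exists (c * k); first exact: idealM.
by exists (c * a); ring.
Qed.

Definition adj K x : ideal R := mk_ideal (@adj0 K x) (@adjD K x) (@adjM K x).

Lemma adjP K x r : (r \in adj K x) <->
  exists2 k : R, k \in K & exists a : R, r = k + a * x.
Proof. exact: mk_idealP. Qed.

Lemma adj_sub K x : {subset K <= adj K x}.
Proof. by move=> k Kk; apply/adjP; exists k => //; exists 0; ring. Qed.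

Lemma adj_mem K x : x \in adj K x.
Proof. by apply/adjP; exists 0; rewrite ?ideal0 //; exists 1; ring. Qed.

Lemma adj_min K x L : {subset K <= L} -> x \in L -> {subset adj K x <= L}.
Proof.
by move=> KL Lx r /adjP[k Kk [a ->]]; apply: idealD; [exact: KL | exact: idealM].
Qed.

(** The head is adjoined to the base first, so [adds K (x :: l)] computes to [adds (adj K x) l];
    this is how a parameter is peeled off a list. *)
Fixpoint adds K l : ideal R := if l is x :: l' then adds (adj K x) l' else K.

Lemma adds_sub K l : {subset K <= adds K l}.
Proof. by elim: l K => [K k //|x l IH K k Kk /=]; apply/IH/adj_sub. Qed.

Lemma adds_mem K l x : x \in l -> x \in adds K l.
Proof.
elim: l K => //= y l IH K; rewrite inE => /predU1P[->|/IH//].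
by apply: adds_sub; exact: adj_mem.
Qed.

Lemma adds_min K l L : {subset K <= L} -> {subset l <= L} ->
  {subset adds K l <= L}.
Proof.
elim: l K => //= x l IH K KL lL; apply: IH.
  by apply: adj_min => //; apply: lL; rewrite mem_head.
by move=> y ly; apply: lL; rewrite inE ly orbT.
Qed.

Lemma adds_eq K L l l' : {subset K <= L} -> {subset l <= l'} ->
  {subset adds K l <= adds L l'}.
Proof.
move=> KL ll'; apply: adds_min => [k /KL|x /ll']; last exact: adds_mem.
exact: adds_sub.
Qed.

Definition zero_ideal : ideal R := gen_seq [::].

Lemma zero_idealP x : (x \in zero_ideal) <-> x = 0.
Proof.
split=> [/genP gx|->]; last exact: ideal0.
have [|||K KE] := @ideal_of_set [set y | y = 0].
- by [].
- by move=> a b -> ->; rewrite addr0.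
- by move=> a b ->; rewrite mulr0.
by apply/KE/gx.
Qed.

Lemma gen_seqE l : gen_seq l =i adds zero_ideal l.
Proof.
move=> x; apply/idP/idP.
  by apply: gen_min => s /= ls; exact: adds_mem.
apply: adds_min => [y /zero_idealP ->|y ly]; first exact: ideal0.
exact: mem_gen.
Qed.

(** Moving the first generator to the end exposes its coefficient: a member becomes one of
    [adds K l] plus a multiple of [x]. *)
Lemma adds_adj K x l : adds (adj K x) l =i adj (adds K l) x.
Proof.
move=> z; apply/idP/idP.
  apply: adds_min; last by move=> y ly; apply/adj_sub/adds_mem.
  by apply: adj_min; [move=> k Kk; apply/adj_sub/adds_sub | exact: adj_mem].
apply: adj_min; last by apply: adds_sub; exact: adj_mem.
by apply: adds_eq => //; exact: adj_sub.
Qed.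

End Ideals.

Ltac in_ideal := repeat first
  [done | apply: idealB | apply: idealD | apply: idealM].

(** * Chain conditions and prime ideals in Noetherian rings *)

Section Noetherian.
Context {R : comNzRingType} (R_noeth : noetherian R).
Implicit Types (K L P Q : ideal R) (l : seq R) (x y z a b : R).

(** The union of the chain has finitely many generators, which all lie in a single [D n]. *)
Lemma ascending_stationary (D : nat -> ideal R) :
  (forall n, {subset D n <= D n.+1}) -> exists n, {subset D n.+1 <= D n}.
Proof.
move=> Dinc.
have Dle n k : (n <= k)%N -> {subset D n <= D k}.
  elim: k => [|k IH]; rewrite ?leqn0 ?ltnS; first by move/eqP->.
  by rewrite leq_eqVlt => /predU1P[->//|/IH DD x /DD /Dinc].
have [|||U UE] := @ideal_of_set R [set x : R | exists n, x \in D n].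
- by exists 0; exact: ideal0.
- move=> x y [n Dx] [k Dy]; exists (maxn n k); apply: idealD.
    by apply: Dle Dx; exact: leq_maxl.
  by apply: Dle Dy; exact: leq_maxr.
- by move=> a x [n Dx]; exists n; exact: idealM.
have [l lE] := R_noeth U.
have [n ln] : exists n, {subset l <= D n}.
  have : {subset l <= U} by move=> x lx; rewrite lE; exact: mem_gen.
  elim: l {lE} => [|x l IH] lU; first by exists 0%N.
  have [y ly|n ln] := IH; first by apply: lU; rewrite inE ly orbT.
  have /UE[k Dx] := lU x (mem_head _ _).
  exists (maxn n k) => y; rewrite inE => /predU1P[->|/ln].
    by apply: Dle Dx; exact: leq_maxr.
  by apply: Dle; exact: leq_maxl.
exists n => x Dx.
have : x \in U by apply/UE; exists n.+1.
by rewrite lE; apply: gen_min.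
Qed.

(** Otherwise, choosing a strictly larger member again and again yields an ascending chain that
    never stops. *)
Lemma noetherian_max (F : ideal R -> Prop) K0 : F K0 ->
  exists K, F K /\ forall L, F L -> {subset K <= L} -> {subset L <= K}.
Proof.
move=> F0; apply: contrapT => noK.
have step (K : {K | F K}) : exists L : {K | F K},
    {subset sval K <= sval L} /\ ~ {subset sval L <= sval K}.
  case: K => K FK /=; apply: contrapT => nL; apply: noK; exists K; split=> // L FL KL.
  by apply: contrapT => nLK; apply: nL; exists (exist _ L FL).
pose D := fix D n := if n is k.+1 then projT1 (cid (step (D k))) else exist F K0 F0.
have DS n : {subset sval (D n) <= sval (D n.+1)} /\
    ~ {subset sval (D n.+1) <= sval (D n)} := projT2 (cid (step (D n))).
have [n Dn] := ascending_stationary (fun n => proj1 (DS n)).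
exact: (proj2 (DS n)).
Qed.

Lemma noetherian_gens K : exists l, {subset l <= K} /\ {subset K <= adds zero_ideal l}.
Proof.
have [l lE] := R_noeth K; exists l; split=> [x lx|x].
  by rewrite lE; exact: mem_gen.
by rewrite lE gen_seqE.
Qed.

(* An ideal maximal among those disjoint from a multiplicative set is prime. *)
Lemma prime_avoiding (W : set R) K : W 1 -> (forall x y, W x -> W y -> W (x * y)) ->
  (forall x, W x -> x \notin K) ->
  exists P, [/\ prime_ideal P, {subset K <= P} & forall x, W x -> x \notin P].
Proof.
move=> W1 WM WK.
have [|P [[KP WP] Pmax]] := @noetherian_max
  (fun L => {subset K <= L} /\ forall x, W x -> x \notin L) K.
  by split.
exists P; split=> //; split; first exact: WP.
move=> x y Pxy; apply: contrapT => /not_orP[Px Py].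
have meet (z : R) : z \notin P -> exists w, W w /\ w \in adj P z.
  move=> Pz; apply: contrapT => nW.
  have /(_ z (adj_mem _ _)) : {subset adj P z <= P}.
    apply: Pmax; last exact: adj_sub.
    split=> [k /KP/adj_sub//|w Ww]; apply/negP => ww.
    by apply: nW; exists w.
  exact/negP.
have [u [Wu /adjP[p Pp [a uE]]]] := meet x (introT negP Px).
have [v [Wv /adjP[q Pq [b vE]]]] := meet y (introT negP Py).
have /negP[] := WP _ (WM _ _ Wu Wv); rewrite uE vE.
have -> : (p + a * x) * (q + b * y) =
    (q + b * y) * p + (a * x) * q + (a * b) * (x * y) by ring.
by in_ideal.
Qed.

End Noetherian.

(** * Localization at a prime, expressed without fractions *)

Section LocalizedStatements.
Context {R : comNzRingType}.
Variables (P : ideal R) (P_prime : prime_ideal P).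
Implicit Types (K L N : ideal R) (l : seq R) (x y z a b : R).

(* Membership in [K] after localization at [P]. *)
Definition loc_mem K x := exists2 s : R, s \notin P & s * x \in K.

Lemma notinM x y : x \notin P -> y \notin P -> x * y \notin P.
Proof.
move=> /negP Px /negP Py; apply/negP => Pxy.
by case: (proj2 P_prime _ _ Pxy).
Qed.

Lemma loc_mem_in K x : x \in K -> loc_mem K x.
Proof. by exists 1; rewrite ?mul1r //; case: P_prime. Qed.

Lemma loc_ideal K : exists L, forall x, (x \in L) <-> loc_mem K x.
Proof.
apply: ideal_of_set.
- by apply: loc_mem_in; exact: ideal0.
- move=> x y [s Ps Kx] [t Pt Ky]; exists (s * t); first exact: notinM.
  have -> : s * t * (x + y) = t * (s * x) + s * (t * y) by ring.
  by in_ideal.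
move=> a x [s Ps Kx]; exists s => //.
by rewrite mulrCA; exact: idealM.
Qed.

Lemma loc_mem_scale K s x : s \notin P -> loc_mem K (s * x) -> loc_mem K x.
Proof.
move=> Ps [t Pt Kx]; exists (t * s); first exact: notinM.
by rewrite -mulrA.
Qed.

Lemma loc_mem_sub K L x : {subset K <= L} -> loc_mem K x -> loc_mem L x.
Proof. by move=> KL [s Ps /KL Lx]; exists s. Qed.

(* A generator [y] of [N] can be dropped: [s y = q + x a] and [t a = k + b y]
   give [(t s - x b) y = t q + x k], where [t s - x b] is invertible at [P]. *)
Lemma loc_nakayama L N x l : x \in P -> {subset l <= N} ->
  {subset N <= adds L l} ->
  (forall g : R, g \in N -> exists2 s : R, s \notin P &
     exists q a : R, [/\ q \in L, a \in N & s * g = q + x * a]) ->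
  forall g : R, g \in N -> loc_mem L g.
Proof.
move=> Px lN Nl NL.
have {Nl} : forall g : R, g \in N -> loc_mem (adds L l) g.
  by move=> g /Nl; exact: loc_mem_in.
elim: l lN => [//|y l IH] lN Nl; apply: IH => [z lz|].
  by apply: lN; rewrite inE lz orbT.
have [L' L'E] := loc_ideal (adds L l).
have yL' : y \in L'.
  have [s Ps [q [a [Lq Na sy]]]] := NL y (lN y (mem_head _ _)).
  have [t Pt] := Nl a Na; rewrite /= adds_adj => /adjP[k Lk [b ta]].
  apply/L'E; exists (t * s - x * b).
    apply/negP => tsxb; have /negP[] := notinM Pt Ps.
    have -> : t * s = t * s - x * b + b * x by ring.
    by apply: idealD => //; exact: idealM.
  have -> : (t * s - x * b) * y = t * q + x * k.
    have -> : (t * s - x * b) * y = t * (s * y) - x * b * y by ring.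
    have -> : t * (s * y) - x * b * y = t * q + x * (t * a) - x * b * y.
      by rewrite sy; ring.
    by rewrite ta; ring.
  by in_ideal; exact: adds_sub.
move=> g /Nl[t Pt]; rewrite /= adds_adj => /adjP[k Lk [b tg]].
apply: (loc_mem_scale Pt); apply/L'E; rewrite tg; in_ideal.
by apply/L'E/loc_mem_in.
Qed.

End LocalizedStatements.

(** * Krull's principal ideal theorem *)

Section PrincipalIdealTheorem.
Context {R : comNzRingType} (R_noeth : noetherian R).
Implicit Types (K L P Q : ideal R) (l : seq R) (x y z a b : R).

Section Descending.
Variables (P : ideal R) (P_prime : prime_ideal P).

(** The descending chain condition for the localization of R/K at [P], stated through chains of
    ideals of R. *)
Definition loc_dcc K := forall D : nat -> ideal R,
  (forall n, {subset D n.+1 <= D n}) -> (forall n, {subset K <= D n}) ->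
  exists n, forall k, (n <= k)%N -> forall r : R, r \in D k -> loc_mem P (D k.+1) r.

(** Locally at [P], the ideal [P] lies in the radical of [K]; over a Noetherian ring this makes the
    localization of R/K Artinian. *)
Definition loc_radical K :=
  forall y : R, y \in P -> exists2 s : R, s \notin P & exists n, s * y ^+ n \in K.

(** Starting from 1, multiply in turn by the highest power of each generator of [P] that keeps the
    element locally nonzero modulo [K]; the result is locally killed by all of [P]. *)
Lemma loc_socle K : loc_radical K -> ~ loc_mem P K 1 ->
  exists z : R, ~ loc_mem P K z /\ forall y : R, y \in P -> loc_mem P K (y * z).
Proof.
move=> Krad K1.
have [l [lP Pl]] := noetherian_gens R_noeth P.
have [KP KPE] := loc_ideal P_prime K.
have [z [Kz lz]] : exists z : R,
    ~ loc_mem P K z /\ forall y : R, y \in l -> loc_mem P K (y * z).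
  elim: l lP {Pl} => [|y l IH] lP; first by exists 1; split.
  have [z [Kz lz]] : exists z : R,
    ~ loc_mem P K z /\ forall y : R, y \in l -> loc_mem P K (y * z).
    by apply: IH => z lz; apply: lP; rewrite inE lz orbT.
  have [s Ps [n syn]] := Krad y (lP y (mem_head _ _)).
  have {syn} : loc_mem P K (y ^+ n * z).
    by exists s => //; rewrite mulrA mulrC; apply: idealM.
  elim: n => [|n IHn]; first by rewrite expr0 mul1r.
  have [/IHn//|yn] := pselect (loc_mem P K (y ^+ n * z)).
  rewrite exprS -mulrA => ynz; exists (y ^+ n * z); split=> // u.
  rewrite inE => /predU1P[->//|/lz uz].
  by rewrite mulrCA; apply/KPE/idealM/KPE.
exists z; split=> // y /Pl.
have [T TE] : exists T : ideal R, forall a, (a \in T) <-> loc_mem P K (a * z).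
  apply: ideal_of_set.
  - by rewrite mul0r; apply/KPE/ideal0.
  - by move=> a b /KPE az /KPE bz; rewrite mulrDl; apply/KPE/idealD.
  - by move=> a b /KPE bz; rewrite -mulrA; apply/KPE/idealM.
move=> yl; apply/TE; apply: adds_min yl => [a /zero_idealP ->|u lu].
  exact: ideal0.
exact/TE/lz.
Qed.

(** Noetherian induction: for [L] maximal among the counterexamples, a socle element [z] spans a
    simple module modulo [L] at [P], so the chain condition above [adj L z] passes down to [L]. *)
Lemma loc_radical_dcc K : loc_radical K -> loc_dcc K.
Proof.
move=> Krad; apply: contrapT => Kdcc.
have [L [[Lrad Ldcc] Lmax]] := noetherian_max R_noeth
  (F := fun L => loc_radical L /\ ~ loc_dcc L) (conj Krad Kdcc).
have L1 : ~ loc_mem P L 1.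
  move=> [s Ps]; rewrite mulr1 => Ls; apply: Ldcc => D _ LD.
  by exists 0%N => k _ r _; exists s => //; rewrite mulrC; apply: idealM; exact: LD.
have [z [Lz Pz]] := loc_socle Lrad L1.
have Lzdcc : loc_dcc (adj L z).
  apply: contrapT => Lzdcc; apply: Lz; apply: loc_mem_in => //.
  apply: (Lmax (adj L z)); [split=> // | exact: adj_sub | exact: adj_mem].
  by move=> y /Lrad[s Ps [n /adj_sub sy]]; exists s => //; exists n.
apply: Ldcc => D Ddec LD.
have Dle n k : (n <= k)%N -> {subset D k <= D n}.
  elim: k => [|k IH]; rewrite ?leqn0 ?ltnS; first by move/eqP->.
  by rewrite leq_eqVlt => /predU1P[->//|/IH DD x /Ddec /DD].
have [||n nD] := Lzdcc (fun n => adj (D n) z).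
- by move=> n; apply: adj_min; [move=> x /Ddec; exact: adj_sub | exact: adj_mem].
- by move=> n; apply: adj_min; [move=> x /(LD n); exact: adj_sub | exact: adj_mem].
(* If [z] lies locally in every [D n], adding it changes nothing locally. If it is missing from
   [D m], then a z in [D m] forces a into [P], and a z is locally in [L]. *)
have [Dz|/existsNP[m Dz]] := pselect (forall n, loc_mem P (D n) z).
  exists n => k nk r Dr.
  have [s Ps /adjP[d Dd [a sr]]] := nD k nk r (adj_sub _ Dr).
  have [DP DPE] := loc_ideal P_prime (D k.+1).
  apply: (loc_mem_scale P_prime Ps); apply/DPE; rewrite sr; in_ideal.
    exact/DPE/loc_mem_in.
  exact/DPE/Dz.
exists (maxn n m) => k; rewrite geq_max => /andP[nk mk] r Dr.
have [s Ps /adjP[d Dd [a sr]]] := nD k nk r (adj_sub _ Dr).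
have Pa : a \in P.
  apply: contrapT => /negP Pa; apply: Dz; exists a => //.
  apply: (Dle m k) => //.
  have -> : a * z = s * r - d by rewrite sr; ring.
  by in_ideal; exact: Ddec.
have [DP DPE] := loc_ideal P_prime (D k.+1).
apply: (loc_mem_scale P_prime Ps); apply/DPE; rewrite sr idealD //.
  exact/DPE/loc_mem_in.
apply/DPE; apply: loc_mem_sub (Pz a Pa); exact: LD.
Qed.

End Descending.

(* Krull's principal ideal theorem, as the replacement of the middle prime of
   [P0 < P1 < P2] by one containing a given [x] in [P2].  If there is none,
   descending chains above [P0 + (x)] are stationary at [P2]; apply this to
   [Y n + (x)], where [Y n] is the contraction of [P0 + (y^n)] from the
   localization at [P1], for some [y] in [P1] outside [P0]. *)
Lemma prime_through P0 P1 P2 x :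
  prime_ideal P0 -> prime_ideal P1 -> prime_ideal P2 ->
  {subset P0 <= P1} -> ~ {subset P1 <= P0} ->
  {subset P1 <= P2} -> ~ {subset P2 <= P1} -> x \in P2 ->
  exists Q, [/\ prime_ideal Q, {subset P0 <= Q}, x \in Q, {subset Q <= P2} &
    ~ {subset P2 <= Q}].
Proof.
move=> P0p P1p P2p P01 P10 P12 P21 P2x; apply: contrapT => noQ.
have P1x : x \notin P1 by apply/negP => P1x; apply: noQ; exists P1; split.
have [y P1y P0y] : exists2 y : R, y \in P1 & y \notin P0.
  apply: contrapT => ny; apply: P10 => y P1y; apply: contrapT => /negP P0y.
  by apply: ny; exists y.
(* Otherwise no s z^n with s outside [P2] lies in [adj P0 x], and a prime avoiding all these
   products is the excluded [Q]. *)
have Krad : loc_radical P2 (adj P0 x).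
  move=> z P2z; apply: contrapT => nz; apply: noQ.
  have [|||Q [Qp KQ WQ]] := @prime_avoiding _ R_noeth
    [set w | exists2 s : R, s \notin P2 & exists n, w = s * z ^+ n] (adj P0 x).
  - by exists 1; [case: P2p | exists 0%N; rewrite mul1r].
  - move=> _ _ [s Ps [n ->]] [t Pt [k ->]]; exists (s * t).
      exact: notinM.
    by exists (n + k)%N; rewrite exprD; ring.
  - move=> _ [s Ps [n ->]]; apply/negP => szn.
    by apply: nz; exists s => //; exists n.
  exists Q; split=> //.
  - by move=> a Pa; apply/KQ/adj_sub.
  - exact/KQ/adj_mem.
  - move=> a Qa; apply: contrapT => /negP Pa.
    by have /negP[] := WQ a (ex_intro2 _ _ a Pa (ex_intro _ 0%N (esym (mulr1 a)))).
  move=> P2Q; have /negP[] : z \notin Q; last exact: P2Q.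
  by apply: WQ; exists 1; [case: P2p | exists 1%N; rewrite mul1r].
pose yP n := adj P0 (y ^+ n).
have yPdec n : {subset yP n.+1 <= yP n}.
  apply: adj_min; first exact: adj_sub.
  by rewrite exprS; apply: idealM; exact: adj_mem.
pose Y n := projT1 (cid (loc_ideal P1p (yP n))).
have YE n r : (r \in Y n) <-> loc_mem P1 (yP n) r :=
  projT2 (cid (loc_ideal P1p (yP n))) r.
have Ydec n : {subset Y n.+1 <= Y n}.
  by move=> r /YE/(loc_mem_sub (@yPdec n))/YE.
have [||n nD] := loc_radical_dcc P2p Krad (D := fun n => adj (Y n) x).
- by move=> n; apply: adj_min; [move=> r /Ydec; exact: adj_sub | exact: adj_mem].
- move=> n; apply: adj_min; last exact: adj_mem.
  by move=> r P0r; apply/adj_sub/YE/loc_mem_in => //; exact: adj_sub.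
have [l [lY Yl]] := noetherian_gens R_noeth (Y n).
(* Locally at [P2], [Y n] is contained in [Y n.+1] plus x times [Y n], because [x] is invertible at
   [P1]; Nakayama then puts [y ^+ n] locally into [Y n.+1]. *)
have [] := @loc_nakayama _ P2 P2p (Y n.+1) (Y n) x l P2x lY _ _ (y ^+ n).
- by move=> g /Yl; apply: adds_eq => // z /zero_idealP ->; exact: ideal0.
- move=> g Yg; have [s Ps /adjP[q Yq [a sg]]] := nD n (leqnn n) g (adj_sub _ Yg).
  exists s => //; exists q, a; split=> //; last by rewrite sg [a * x]mulrC.
  apply/YE; apply: (loc_mem_scale P1p P1x); apply/YE.
  have -> : x * a = s * g - q by rewrite sg; ring.
  by in_ideal; exact: Ydec.
- by apply/YE/loc_mem_in => //; exact: adj_mem.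
(* Now t s y^n = p + a y^(n+1) with p in [P0]. As [y] is outside [P0], the factor t s - a y is in
   [P0], so t s is in [P1], a contradiction. *)
move=> s Ps /YE[t Pt /adjP[p P0p' [a E]]].
have P0E : y ^+ n * (t * s - a * y) \in P0.
  suff -> : y ^+ n * (t * s - a * y) = p by [].
  by apply: (addIr (a * y ^+ n.+1)); rewrite -E exprS; ring.
have P1s : s \notin P1 by apply: contra Ps; exact: P12.
have /negP[] := notinM P1p Pt P1s.
case: (proj2 P0p _ _ P0E) => [yn|tsay].
  have : y ^+ n \notin P0.
    by elim: (n) => [|k IH]; [case: P0p | rewrite exprS notinM].
  by rewrite yn.
rewrite -[t * s](subrK (a * y)); apply: idealD; first exact: P01.
exact: idealM.
Qed.

End PrincipalIdealTheorem.

(** * Parameters of a local ring *)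

Section LocalRings.
Context {R : comNzRingType}.
Variable m : ideal R.
Hypotheses (R_noeth : noetherian R) (m_local : local_ring m).
Implicit Types (K L P Q : ideal R) (l : seq R) (x y z a b : R).

Lemma proper_sub_max K : 1 \notin K -> {subset K <= m}.
Proof.
move=> K1; have [L [[KL L1] Lmax]] := noetherian_max R_noeth
  (F := fun L => {subset K <= L} /\ 1 \notin L) (conj (fun=> id) K1).
have : maximal_ideal L.
  split=> // L' LL' L'1; apply: Lmax => //; split=> // x /KL; exact: LL'.
by move=> /(proj2 m_local) Lm x /KL; rewrite Lm.
Qed.

Lemma notin_max_unit a : a \notin m -> exists b, b * a = 1.
Proof.
move=> ma; have : 1 \in adj zero_ideal a.
  apply: contrapT => /negP/proper_sub_max/(_ a (adj_mem _ _)).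
  exact/negP.
by move=> /adjP[_ /zero_idealP -> [b]]; rewrite add0r => ba; exists b.
Qed.

Lemma max_prime : prime_ideal m.
Proof.
have m1 : 1 \notin m := proj1 (proj1 m_local).
split=> // x y mxy; apply: contrapT => /not_orP[/negP mx /negP my].
have [b bx] := notin_max_unit mx; have [c cy] := notin_max_unit my.
have /negP[] := m1.
have -> : 1 = b * c * (x * y) by rewrite -[LHS]mulr1 -{1}bx -cy; ring.
exact: idealM.
Qed.

Lemma prime_sub_max P : prime_ideal P -> {subset P <= m}.
Proof. by move=> [P1 _]; exact: proper_sub_max. Qed.

Lemma loc_mem_max K x : loc_mem m K x -> x \in K.
Proof.
move=> [s /notin_max_unit[b bs]] sx.
by rewrite -[x]mul1r -bs -mulrA; exact: idealM.
Qed.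

Definition proper_sub P Q := {subset P <= Q} /\ ~ {subset Q <= P}.

(** The number [n] counts inclusions, not primes. The recursion climbs from the bottom prime, where
    the chains get modified below. *)
Fixpoint chain_from n P : Prop := prime_ideal P /\
  if n is k.+1 then exists Q, proper_sub P Q /\ chain_from k Q else True.

Lemma chain_from_prime n P : chain_from n P -> prime_ideal P.
Proof. by case: n => [|n] []. Qed.

(** By induction, the part from the second prime on can be exchanged for a shorter chain starting
    with a prime that contains [x]; [prime_through] then replaces the second prime. *)
Lemma chain_from_through n P x : x \in m -> chain_from n.+1 P ->
  exists Q, [/\ {subset P <= Q}, x \in Q & chain_from n Q].
Proof.
move=> mx; elim: n P => [|n IH] P [Pp [P1 [[PP1 P1P] cP1]]].
  exists m; split=> //; first exact: prime_sub_max.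
  by split=> //; exact: max_prime.
have {}cP1 : chain_from n.+1 P1 := cP1.
have [P1x|/negP P1x] := pselect (x \in P1); first by exists P1.
have [P2 [P12 P2x cP2]] := IH P1 cP1.
have [|Q [Qp PQ Qx QP2 P2Q]] := prime_through R_noeth Pp (chain_from_prime cP1)
  (chain_from_prime cP2) PP1 P1P P12 _ P2x.
  by move=> P21; move: P1x; rewrite (P21 x).
exists Q; split=> //; split=> //; exists P2; split=> //.
Qed.

(** Some generator [x] is outside [P], as the chain rises strictly. A chain one step shorter starts
    at some [Q] containing [P] and [x], and by induction [Q] lies in K + (x). Hence [P] lies in K +
    x P, and Nakayama's lemma applies. *)
Lemma bottom_of_chain n K l P : size l = n -> m =i adds K l ->
  {subset K <= P} -> chain_from n P -> {subset P <= K}.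
Proof.
elim: n K l P => [|n IH] K l P.
  move=> /size0nil -> mK _ /chain_from_prime/prime_sub_max Pm x /Pm.
  by rewrite mK.
move=> ln mK KP cP; have [Pp [P1 [[PP1 P1P] /chain_from_prime P1p]]] := cP.
have [x lx Px] : exists2 x, x \in l & x \notin P.
  apply: contrapT => lP; apply: P1P => y /(prime_sub_max P1p).
  rewrite mK; apply: adds_min y => // x lx; apply: contrapT => /negP Px.
  by apply: lP; exists x.
have mx : x \in m by rewrite mK; exact: adds_mem.
have [Q [PQ Qx cQ]] := chain_from_through mx cP.
have QK : {subset Q <= adj K x}.
  apply: (IH _ (rem x l)) => //; first by rewrite size_rem // ln.
    move=> y; rewrite mK; apply/idP/idP.
      apply: adds_min => [k Kk|z]; first exact/adds_sub/adj_sub.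
      rewrite (perm_mem (perm_to_rem lx)) inE => /predU1P[->|]; last exact: adds_mem.
      exact/adds_sub/adj_mem.
    apply: adds_min => [|z /mem_rem]; last exact: adds_mem.
    by apply: adj_min; [exact: adds_sub | exact: adds_mem].
  by apply: adj_min => // k /KP/PQ.
have [g [gP Pg]] := noetherian_gens R_noeth P.
move=> p Pp'; apply: loc_mem_max.
apply: (loc_nakayama max_prime mx gP) Pp'.
  by move=> y /Pg; apply: adds_eq => // z /zero_idealP ->; exact: ideal0.
move=> y Py; have /adjP[k Kk [a ya]] := QK y (PQ y Py).
exists 1; first by case: max_prime.
exists k, a; rewrite mul1r [x * a]mulrC; split=> //.
have : a * x \in P.
  have -> : a * x = y - k by rewrite ya; ring.
  by apply: idealB => //; exact: KP.
by case/(proj2 Pp) => //; rewrite (negPf Px).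
Qed.

Lemma no_long_chain K l P : m =i adds K l -> {subset K <= P} ->
  ~ chain_from (size l).+1 P.
Proof.
move=> mK KP [Pp [Q [[PQ QP] cQ]]]; apply: QP => x.
have KQ : {subset K <= Q} by move=> y /KP/PQ.
by move=> /(bottom_of_chain erefl mK KQ cQ)/KP.
Qed.

(* [l] is a regular system of parameters of the local ring [R / K]. *)
Definition params K l := m =i adds K l /\
  exists P, {subset K <= P} /\ chain_from (size l) P.

(** The chain has the greatest possible length, so its bottom prime coincides with [K]. *)
Lemma params_prime K l : params K l -> prime_ideal K.
Proof.
move=> [mK [P [KP cP]]]; have PK := bottom_of_chain erefl mK KP cP.
have [P1 PM] := chain_from_prime cP.
split; first by apply: contra P1; exact: KP.
by move=> x y /KP/PM[/PK|/PK]; [left|right].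
Qed.

(** If [x] were in [K], the shorter list [l] would generate [m] over [K], and the chain would be too
    long for it. *)
Lemma params_notin K x l : params K (x :: l) -> x \notin K.
Proof.
move=> [mK [P [KP cP]]]; apply/negP => Kx.
apply: (@no_long_chain K l P) => //.
move=> y; rewrite mK /=; apply/idP/idP; apply: adds_eq => //; last exact: adj_sub.
exact: adj_min.
Qed.

Lemma params_adj K x l : params K (x :: l) -> params (adj K x) l.
Proof.
move=> [mK [P [KP cP]]]; split=> //.
have mx : x \in m by rewrite mK; apply: adds_mem; exact: mem_head.
have [Q [PQ Qx cQ]] := chain_from_through mx cP.
exists Q; split=> //; apply: adj_min => // k /KP; exact: PQ.
Qed.

Lemma params_gens K l l' : size l = size l' -> adds K l =i adds K l' ->
  params K l -> params K l'.
Proof.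
move=> ll' lE [mK H]; rewrite /params -ll'; split=> // x.
by rewrite mK lE.
Qed.

Lemma params_perm K l l' : perm_eq l l' -> params K l -> params K l'.
Proof.
move=> ll'; apply: params_gens; first exact: perm_size.
by move=> x; apply/idP/idP; apply: adds_eq => // y; rewrite (perm_mem ll').
Qed.

Lemma rsop_params s : regular_system_of_parameters m s -> params zero_ideal s.
Proof.
move=> [[[P Pp Pinc] _] _ ms]; split; first by move=> x; rewrite ms gen_seqE.
(* The chain has [size s + 1] primes, so [k] inclusions remain above index [size s - k]. *)
suff H k : (k <= size s)%N -> chain_from k (P (inord (size s - k))).
  exists (P (inord 0)); split; first by move=> x /zero_idealP ->; exact: ideal0.
  by have := H _ (leqnn _); rewrite subnn.
elim: k => [_|k IH ks]; first by split.
split; first exact: Pp.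
exists (P (inord (size s - k))); split; last by apply: IH; exact: ltnW.
apply: Pinc; rewrite !inordK ?ltnS ?leq_subr //.
by rewrite ltn_sub2l.
Qed.

(* The second alternative expresses [y \in K + m (u)]. *)
Lemma exchange K y (u : seq R) : y \in adds K u ->
  (exists u1 x u2, u = u1 ++ x :: u2 /\ x \in adds K (y :: u1 ++ u2)) \/
  (forall L, {subset K <= L} ->
     (forall a z, a \in m -> z \in u -> a * z \in L) -> y \in L).
Proof.
elim: u y => [|x u IH] y; first by right=> L KL _; exact: KL.
rewrite /= adds_adj => /adjP[y' uy' [a ya]].
(* A unit coefficient [a] allows solving for [x] in terms of [y] and the later elements; otherwise
   the summand [a * x] is in m (u). *)
have [ma|/negP ma] := pselect (a \in m); last first.
  left; exists [::], x, u; split=> //=; have [b ba] := notin_max_unit ma.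
  have -> : x = b * y - b * y' by rewrite ya -[LHS]mul1r -ba; ring.
  apply: idealB; apply: idealM; first by apply: adds_sub; exact: adj_mem.
  by move: uy'; apply: adds_eq => //; exact: adj_sub.
case: (IH y' uy') => [[u1 [z [u2 [-> zu]]]]|y'L]; [left|right].
  exists (x :: u1), z, u2; split=> //; move: zu.
  rewrite [adds K (y' :: _)]/=; apply: adds_min.
    apply: adj_min; first by move=> k Kk; apply/adds_sub/adj_sub.
    have -> : y' = y - a * x by rewrite ya; ring.
    apply: idealB; first by apply: adds_sub; exact: adj_mem.
    by apply: idealM; apply: adds_mem; exact: mem_head.
  by move=> w uw; apply: adds_mem; rewrite inE uw orbT.
move=> L KL uL; rewrite ya; apply: idealD; last by apply: uL => //; exact: mem_head.
by apply: y'L => // b z mb uz; apply: uL => //; rewrite inE uz orbT.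
Qed.

(** A parameter is not in the square of [m], which excludes the second alternative of [exchange]. *)
Lemma exchange_params y l (u : seq R) : params zero_ideal (y :: l) ->
  {subset u <= m} -> y \in adds zero_ideal u ->
  exists u1 x u2, u = u1 ++ x :: u2 /\ x \in adds zero_ideal (y :: u1 ++ u2).
Proof.
move=> yl um yu; case: (exchange yu) => // yL.
have [my _] := yl.
have my' : y \in m by rewrite my; apply: adds_mem; exact: mem_head.
(* [L] is (l) + m y, which contains the square of [m]. With [y] in [L], the unit 1 - c multiplies
   [y] into (l), so [l] alone would generate [m]. *)
have [|||L LE] := @ideal_of_set R [set w : R | exists2 c : R, c \in m &
    w - c * y \in adds zero_ideal l].
- by exists 0; rewrite ?mul0r ?subr0; exact: ideal0.
- move=> v w [c mc vc] [d md wd]; exists (c + d); first exact: idealD.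
  have -> : v + w - (c + d) * y = (v - c * y) + (w - d * y) by ring.
  exact: idealD.
- move=> a w [c mc wc]; exists (a * c); first exact: idealM.
  have -> : a * w - a * c * y = a * (w - c * y) by ring.
  exact: idealM.
have /LE[c mc yc] : y \in L.
  apply: yL => [w /zero_idealP ->|a z ma /um]; first exact: ideal0.
  rewrite my /= adds_adj => /adjP[g lg [b zb]]; apply/LE.
  exists (b * a); first exact: idealM.
  have -> : a * z - b * a * y = a * g by rewrite zb; ring.
  exact: idealM.
have ly : y \in adds zero_ideal l.
  have [|b bc] := @notin_max_unit (1 - c).
    apply/negP => m1c; have /negP[] := proj1 max_prime.
    by rewrite -(subrK c 1); exact: idealD.
  have -> : y = b * (y - c * y) by rewrite -[LHS]mul1r -bc; ring.
  exact: idealM.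
have [P [zP cP]] := proj2 yl; case: (@no_long_chain zero_ideal l P _ zP cP).
move=> x; rewrite my /= adds_adj; apply/idP/idP; last exact: adj_sub.
exact: adj_min.
Qed.

End LocalRings.

(** * Comparison of injective resolutions *)

Section Homological.
Context {R : comNzRingType}.

Definition mk_linear (U V : lmodType R) (f : U -> V) (f_lin : linear f) :
    {linear U -> V} :=
  HB.pack f (GRing.isLinear.Build R U V _ f f_lin).

Lemma mk_linearE (U V : lmodType R) (f : U -> V) (f_lin : linear f) x :
  mk_linear f_lin x = f x.
Proof. by []. Qed.

(** As [g] kills the kernel of [f], it descends to the image of [f], a submodule of [B]. *)
Lemma injective_extend (E A B : lmodType R) (f : {linear A -> B})
    (g : {linear A -> E}) : injective_module E ->
  (forall a, f a = 0 -> g a = 0) ->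
  exists h : {linear B -> E}, forall a, h (f a) = g a.
Proof.
move=> Einj fg.
have pre (b : submod (im f)) : exists a, f a = val b.
  by have /mk_submodP[a _ fa] := valP b; exists a.
pose g' b := g (projT1 (cid (pre b))).
have g'E a b : f a = val b -> g' b = g a.
  move=> fa; apply/eqP; rewrite -subr_eq0 -linearB; apply/eqP/fg.
  by rewrite linearB fa (projT2 (cid (pre b))) subrr.
have g'_lin : linear g'.
  move=> r b c; have [x fx] := pre b; have [y fy] := pre c.
  rewrite (g'E x b fx) (g'E y c fy) (g'E (r *: x + y)) ?linearP //.
  by rewrite fx fy.
have [h hE] := Einj _ _ (val : {linear submod (im f) -> B}) (mk_linear g'_lin) val_inj.
exists h => a.
have fa : f a \in im f by apply/mk_submodP; exists a.
by have := hE (exist _ (f a) fa); rewrite mk_linearE => /= ->; exact: g'E.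
Qed.

Lemma injective_prod (E F : lmodType R) : injective_module E ->
  injective_module F -> injective_module (E * F)%type.
Proof.
move=> Einj Finj A B f g f_inj.
have g1 : linear (fun a => (g a).1) by move=> r x y; rewrite linearP.
have g2 : linear (fun a => (g a).2) by move=> r x y; rewrite linearP.
have [h1 h1E] := Einj _ _ f (mk_linear g1) f_inj.
have [h2 h2E] := Finj _ _ f (mk_linear g2) f_inj.
have h_lin : linear (fun b => (h1 b, h2 b)).
  by move=> r x y; rewrite !linearP.
exists (mk_linear h_lin) => a; rewrite /= h1E h2E /=.
by case: (g a).
Qed.

Section Exactness.
Variables (M : lmodType R) (E : inj_resolution M).

Lemma res_d_aug x : res_d E 0 (res_aug E x) = 0.
Proof.
have : [set x | res_d E 0 x = 0] (res_aug E x) by rewrite -res_exact0; exists x.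
by [].
Qed.

Lemma res_dd n x : res_d E n.+1 (res_d E n x) = 0.
Proof.
have : [set x | res_d E n.+1 x = 0] (res_d E n x).
  by rewrite -res_exactS; exists x.
by [].
Qed.

Lemma res_lift_aug x : res_d E 0 x = 0 -> exists y, res_aug E y = x.
Proof.
move=> dx; have : range (res_aug E) x by rewrite res_exact0.
by case=> y _ <-; exists y.
Qed.

Lemma res_lift_d n x : res_d E n.+1 x = 0 -> exists y, res_d E n y = x.
Proof.
move=> dx; have : range (res_d E n) x by rewrite res_exactS.
by case=> y _ <-; exists y.
Qed.

End Exactness.

Section Comparison.
Variables (M : lmodType R) (E : inj_resolution M).
Variables (F : nat -> lmodType R) (dF : forall n, {linear F n -> F n.+1}).
Hypotheses (F_inj : forall n, injective_module (F n)).
Hypothesis dF_dF : forall n x, dF n.+1 (dF n x) = 0.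

(** Here [F] is any complex of injectives: besides a resolution, it will be the torsion part of one,
    or a shifted resolution with negated differentials. *)
Lemma comparison (f : {linear M -> F 0%N}) : (forall x, dF 0%N (f x) = 0) ->
  exists phi : forall n, {linear res_mod E n -> F n},
    (forall x, phi 0%N (res_aug E x) = f x) /\
    forall n x, phi n.+1 (res_d E n x) = dF n (phi n x).
Proof.
move=> df.
(* The condition carried along with each map is what lets its composite with the next differential
   be extended. *)
pose St n := {p : {linear res_mod E n -> F n} |
  forall x, res_d E n x = 0 -> dF n (p x) = 0}.
have [p0 p0E] : exists p0 : {linear res_mod E 0 -> F 0%N},
    forall x, p0 (res_aug E x) = f x.
  apply: injective_extend => // x; rewrite -(linear0 (res_aug E)).
  by move=> /res_aug_inj ->; rewrite linear0.
have p0d x : res_d E 0 x = 0 -> dF 0%N (p0 x) = 0.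
  by move=> /res_lift_aug[y <-]; rewrite p0E df.
have step n (p : St n) : exists q : St n.+1,
    forall x, sval q (res_d E n x) = dF n (sval p x).
  case: p => p pd /=.
  have [q qE] := @injective_extend _ _ _ (res_d E n) (dF n \o p) (@F_inj n.+1) pd.
  have qd x : res_d E n.+1 x = 0 -> dF n.+1 (q x) = 0.
    by move=> /res_lift_d[y <-]; rewrite qE /= dF_dF.
  by exists (exist _ q qd).
pose phi := fix phi n : St n :=
  if n is k.+1 then projT1 (cid (step k (phi k))) else exist _ p0 p0d.
exists (fun n => sval (phi n)); split=> [x|n x]; first exact: p0E.
exact: (projT2 (cid (step n (phi n)))).
Qed.

Lemma homotopy (phi : forall n, {linear res_mod E n -> F n}) :
  (forall x, phi 0%N (res_aug E x) = 0) ->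
  (forall n x, phi n.+1 (res_d E n x) = dF n (phi n x)) ->
  exists s : forall n, {linear res_mod E n.+1 -> F n},
    (forall x, phi 0%N x = s 0%N (res_d E 0 x)) /\
    forall n x, phi n.+1 x = s n.+1 (res_d E n.+1 x) + dF n (s n x).
Proof.
move=> phi0 phid.
pose St n := {s : {linear res_mod E n.+1 -> F n} |
  forall x, dF n (phi n x - s (res_d E n x)) = 0}.
have [s0 s0E] : exists s0 : {linear res_mod E 1 -> F 0%N},
    forall x, s0 (res_d E 0 x) = phi 0%N x.
  by apply: injective_extend => // x /res_lift_aug[y <-].
have s0d x : dF 0%N (phi 0%N x - s0 (res_d E 0 x)) = 0.
  by rewrite s0E subrr linear0.
have step n (s : St n) : exists t : St n.+1,
    forall x, sval t (res_d E n.+1 x) = phi n.+1 x - dF n (sval s x).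
  case: s => s sd /=.
  have [|t tE] := @injective_extend _ _ _ (res_d E n.+1)
    (phi n.+1 \- (dF n \o s)) (@F_inj n.+1).
    move=> x /res_lift_d[y <-] /=.
    by rewrite phid -linearB sd.
  have td x : dF n.+1 (phi n.+1 x - t (res_d E n.+1 x)) = 0.
    by rewrite tE /= opprB addrC subrK dF_dF.
  by exists (exist _ t td).
pose sS := fix sS n : St n :=
  if n is k.+1 then projT1 (cid (step k (sS k))) else exist _ s0 s0d.
exists (fun n => sval (sS n)); split=> [x|n x]; first by rewrite /= s0E.
by rewrite (projT2 (cid (step n (sS n)))) subrK.
Qed.

End Comparison.

(** * Cohomology of the torsion subcomplex of a resolution *)

Section Cochains.
Variable I : ideal R.

Lemma torsion_linear (M N : lmodType R) (f : {linear M -> N}) x :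
  x \in torsion I M -> f x \in torsion I N.
Proof.
move=> /torsionP[n xn]; apply/torsionP; exists n => r Ir.
by rewrite -linearZ_LR xn ?linear0.
Qed.

Section Classes.
Variables (M : lmodType R) (E : inj_resolution M).

(** Cocycles and coboundaries of the complex [Gamma I E] are kept as elements of [E]; classes are
    compared by asking whether a difference is a coboundary. *)
Definition cocycle n (z : res_mod E n) : Prop :=
  z \in torsion I (res_mod E n) /\ res_d E n z = 0.

Definition cobound n : res_mod E n -> Prop :=
  if n is k.+1 then fun z =>
    exists2 w, w \in torsion I (res_mod E k) & res_d E k w = z
  else fun z => z = 0.

Lemma cobound0 n : cobound (0 : res_mod E n).
Proof. by case: n => [//|n]; exists 0; rewrite ?rpred0 ?linear0. Qed.

Lemma coboundD n (y z : res_mod E n) : cobound y -> cobound z -> cobound (y + z).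
Proof.
case: n y z => [|n] y z; first by move=> /= -> ->; rewrite addr0.
move=> [v Tv <-] [w Tw <-]; exists (v + w); last by rewrite linearD.
exact: rpredD.
Qed.

Lemma coboundZ n a (z : res_mod E n) : cobound z -> cobound (a *: z).
Proof.
case: n z => [|n] z; first by move=> /= ->; rewrite scaler0.
move=> [w Tw <-]; exists (a *: w); last by rewrite linearZ_LR.
exact: rpredZ.
Qed.

Lemma coboundN n (z : res_mod E n) : cobound z -> cobound (- z).
Proof. by rewrite -scaleN1r; exact: coboundZ. Qed.

Lemma cobound_sub n (y z : res_mod E n) : cobound (y - z) -> cobound z -> cobound y.
Proof. by move=> Byz Bz; rewrite -(subrK z y); exact: coboundD. Qed.

Lemma cobound_subC n (y z : res_mod E n) : cobound (y - z) -> cobound (z - y).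
Proof. by rewrite -opprB => /coboundN; rewrite opprK. Qed.

Lemma cobound_trans n (x y z : res_mod E n) :
  cobound (x - y) -> cobound (y - z) -> cobound (x - z).
Proof. by move=> Bxy Byz; rewrite -(subrKA y); exact: coboundD. Qed.

Lemma cocycle0 n : cocycle (0 : res_mod E n).
Proof. by split; rewrite ?rpred0 ?linear0. Qed.

Lemma cocycleZ n a (z : res_mod E n) : cocycle z -> cocycle (a *: z).
Proof. by move=> [Tz dz]; split; [exact: rpredZ | rewrite linearZ_LR dz scaler0]. Qed.

End Classes.

Definition chain_map (M N : lmodType R) (E : inj_resolution M)
    (F : inj_resolution N) (phi : forall n, {linear res_mod E n -> res_mod F n}) :=
  forall n x, phi n.+1 (res_d E n x) = res_d F n (phi n x).

Definition lifts (M N : lmodType R) (f : {linear M -> N}) (E : inj_resolution M)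
    (F : inj_resolution N) (phi : forall n, {linear res_mod E n -> res_mod F n}) :=
  chain_map phi /\ forall x, phi 0%N (res_aug E x) = res_aug F (f x).

Lemma exists_lift (M N : lmodType R) (f : {linear M -> N}) (E : inj_resolution M)
  (F : inj_resolution N) :
  exists phi : forall n, {linear res_mod E n -> res_mod F n}, lifts f phi.
Proof.
have [|phi [phi0 phid]] := @comparison M E (res_mod F) (res_d F) (@res_injective _ _ F)
  (@res_dd _ F) (res_aug F \o f).
  by move=> x; exact: res_d_aug.
by exists phi.
Qed.

Section ChainMaps.
Variables (M N : lmodType R) (E : inj_resolution M) (F : inj_resolution N).
Implicit Types phi psi : forall n, {linear res_mod E n -> res_mod F n}.

Lemma cocycle_map phi n z : chain_map phi -> cocycle z -> cocycle (phi n z).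
Proof.
move=> phid [Tz dz]; split; first exact: torsion_linear.
by rewrite -phid dz linear0.
Qed.

Lemma cobound_map phi n z : chain_map phi -> cobound z -> cobound (phi n z).
Proof.
move=> phid; case: n z => [|n] z; first by move=> /= ->; rewrite linear0.
by move=> [w Tw <-]; exists (phi n w); [exact: torsion_linear | rewrite phid].
Qed.

(** Linear maps preserve torsion, so a null homotopy restricts to the torsion subcomplexes. *)
Lemma cobound_null phi n z : chain_map phi ->
  (forall x, phi 0%N (res_aug E x) = 0) -> cocycle z -> cobound (phi n z).
Proof.
move=> phid phi0 [Tz dz].
have [s [s0 sS]] := homotopy (@res_injective _ _ F) (@res_dd _ F) phi0 phid.
case: n z Tz dz => [|n] z Tz dz; first by rewrite /= s0 dz linear0.
exists (s n z); first exact: torsion_linear.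
by rewrite sS dz linear0 add0r.
Qed.

Lemma lifts_unique (f : {linear M -> N}) phi psi n z : lifts f phi -> lifts f psi ->
  cocycle z -> cobound (phi n z - psi n z).
Proof.
move=> [phid phi0] [psid psi0].
apply: (@cobound_null (fun n => phi n \- psi n)) => [k x|x] /=.
  by rewrite phid psid linearB.
by rewrite phi0 psi0 subrr.
Qed.

End ChainMaps.

Lemma lifts_comp (M N L : lmodType R) (f : {linear M -> N}) (g : {linear N -> L})
    (E : inj_resolution M) (F : inj_resolution N) (G : inj_resolution L)
    (phi : forall n, {linear res_mod E n -> res_mod F n})
    (psi : forall n, {linear res_mod F n -> res_mod G n}) :
  lifts f phi -> lifts g psi -> lifts (g \o f) (fun n => psi n \o phi n).
Proof.
move=> [phid phi0] [psid psi0]; split=> [n x|x] /=; first by rewrite phid psid.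
by rewrite phi0 psi0.
Qed.

(** Serves with [a = 1] for the identity and with a ring element [x] for multiplication by [x] on
    cohomology. *)
Lemma lifts_scale (M : lmodType R) (E : inj_resolution M) a (f : {linear M -> M}) :
  (forall x, f x = a *: x) ->
  lifts f (fun n => a \*: (idfun : {linear res_mod E n -> res_mod E n})).
Proof.
move=> fE; split=> [n x|x] /=; first by rewrite linearZ_LR.
by rewrite fE linearZ_LR.
Qed.

Lemma compare (M : lmodType R) (E F : inj_resolution M) :
  exists (phi : forall n, {linear res_mod E n -> res_mod F n})
         (psi : forall n, {linear res_mod F n -> res_mod E n}),
  [/\ lifts idfun phi, lifts idfun psi,
     forall n z, cocycle z -> cobound (psi n (phi n z) - z) &
     forall n z, cocycle z -> cobound (phi n (psi n z) - z)].
Proof.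
have [phi phiL] := exists_lift idfun E F.
have [psi psiL] := exists_lift idfun F E.
exists phi, psi; split=> // n z Cz.
  have := lifts_unique (lifts_comp phiL psiL)
    (@lifts_scale _ E 1 (idfun \o idfun) _) Cz.
  by rewrite /= scale1r; apply=> x; rewrite scale1r.
have := lifts_unique (lifts_comp psiL phiL)
  (@lifts_scale _ F 1 (idfun \o idfun) _) Cz.
by rewrite /= scale1r; apply=> x; rewrite scale1r.
Qed.

Definition vanishes (M : lmodType R) n :=
  forall (E : inj_resolution M) (z : res_mod E n), cocycle z -> cobound z.

Lemma vanishes_by (M : lmodType R) (E : inj_resolution M) n :
  (forall z : res_mod E n, cocycle z -> cobound z) -> vanishes M n.
Proof.
move=> EV F z Cz; have [phi [psi [[phid _] [psid _] _ phipsi]]] := compare E F.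
apply: cobound_sub (cobound_subC (phipsi n z Cz)) _.
by apply: cobound_map => //; apply/EV/cocycle_map.
Qed.

End Cochains.
End Homological.

(** * Associated primes of cohomology *)

Section AssociatedPrimes.
Context {R : comNzRingType}.
Implicit Types (M N : lmodType R).

Definition prime_set (P : set R) : Prop :=
  ~ P 1 /\ forall x y, P (x * y) -> P x \/ P y.

Lemma mem_ann M (x : M) a : (a \in ann x) <-> (a *: x = 0).
Proof.
by split=> /(mk_submodP (M := R^o) (ann0 x) (@annD _ _ x) (@annZ _ _ x)).
Qed.

Lemma prime_ann M (x : M) : prime_ideal (ann x) <-> prime_set [set a : R | a *: x = 0].
Proof.
split=> [[x1 xM]|[x1 xM]]; split.
- by move=> /mem_ann; apply/negP.
- by move=> a b /mem_ann/xM[/mem_ann|/mem_ann]; [left|right].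
- by apply/negP => /mem_ann.
- by move=> a b /mem_ann/xM[/mem_ann|/mem_ann]; [left|right].
Qed.

Lemma mem_Ass M (P : set R) : Ass M P <->
  exists x : M, (forall a, P a <-> a *: x = 0) /\ prime_set P.
Proof.
have annE (x : M) : [set` ann x] = [set a : R | a *: x = 0].
  by apply/seteqP; split=> a /mem_ann.
split=> [[x /= /prime_ann xp <-]|[x [PE Pp]]].
  by exists x; rewrite annE.
have {}PE : P = [set a : R | a *: x = 0] by apply/seteqP; split=> a /PE.
by exists x; rewrite ?annE //=; apply/prime_ann; rewrite -PE.
Qed.

Lemma mem_Ass_cohomology (U V W : lmodType R) (f : {linear U -> V})
    (g : {linear V -> W}) (P : set R) : Ass (cohomology f g) P <->
  exists v, [/\ g v = 0, forall a, P a <-> range f (a *: v) & prime_set P].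
Proof.
set D := Defs.preim (\val : {linear submod (ker g) -> V}) (im f).
have piE (w : submod (ker g)) a :
    (a *: quotmod_pi D w = 0) <-> range f (a *: val w).
  rewrite -linearZ_LR -(linear0 (quotmod_pi D)).
  have := quotmod_pi_eq D (a *: w) 0; rewrite subr0 => ->.
  split=> [/mk_submodP/mk_submodP|H]; first by rewrite linearZ_LR.
  by apply/mk_submodP/mk_submodP; rewrite linearZ_LR.
split=> [/mem_Ass[x [PE Pp]]|[v [gv PE Pp]]].
  have [w wx] := quotmod_pi_surj x; have /mk_submodP gw := valP w.
  exists (val w); split=> // a; rewrite PE -wx; exact: piE.
have kv : v \in ker g by apply/mk_submodP.
apply/mem_Ass; exists (quotmod_pi D (exist _ v kv)); split=> // a.
by rewrite PE; symmetry; exact: piE.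
Qed.

Variable I : ideal R.

Definition Ass_classes M (E : inj_resolution M) n : set (set R) :=
  [set P | exists z : res_mod E n,
    [/\ cocycle I z, forall a, P a <-> cobound I (a *: z) & prime_set P]].

Lemma Ass_derived_Gamma M (E : inj_resolution M) n :
  Ass (derived_Gamma I E n) = Ass_classes E n.
Proof.
apply/seteqP; split=> P.
  case: n => [|n] /mem_Ass_cohomology[v [dv PE Pp]];
    exists (val v); split=> //.
  - split; first exact: valP.
    by have /(congr1 val) := dv.
  - move=> a; rewrite PE; split=> [[w _ /(congr1 val)]|/= av].
      by rewrite linearZ_LR => <-.
    by exists 0 => //=; apply: val_inj; rewrite linearZ_LR.
  - split; first exact: valP.
    by have /(congr1 val) := dv.
  - move=> a; rewrite PE; split=> [[w _ /(congr1 val)]|[w Tw dw]].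
      by rewrite linearZ_LR /= => <-; exists (val w) => //; exact: valP.
    by exists (exist _ w Tw) => //=; apply: val_inj; rewrite linearZ_LR.
move=> [z [[Tz dz] PE Pp]].
case: n z Tz dz PE => [|n] z Tz dz PE; apply/mem_Ass_cohomology;
  exists (exist _ z Tz); split=> //.
- exact: val_inj.
- move=> a; rewrite PE; split=> [az|[w _ /(congr1 val)]].
    by exists 0 => //=; apply: val_inj; rewrite linearZ_LR.
  by rewrite linearZ_LR => <-.
- exact: val_inj.
move=> a; rewrite PE; split=> [[w Tw dw]|[w _ /(congr1 val)]].
  by exists (exist _ w Tw) => //=; apply: val_inj; rewrite linearZ_LR.
by rewrite linearZ_LR /= => <-; exists (val w) => //; exact: valP.
Qed.

Lemma Ass_classes_sub M N (E : inj_resolution M) (F : inj_resolution N) n k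
    (g : {linear res_mod E n -> res_mod F k}) :
  (forall z, cocycle I z -> cocycle I (g z)) ->
  (forall z, cocycle I z -> cobound I z <-> cobound I (g z)) ->
  Ass_classes E n `<=` Ass_classes F k.
Proof.
move=> gC gB P [z [Cz PE Pp]]; exists (g z); split=> //; first exact: gC.
by move=> a; rewrite PE gB ?linearZ_LR //; exact: cocycleZ.
Qed.

Lemma Ass_classes_indep M (E F : inj_resolution M) n :
  Ass_classes E n `<=` Ass_classes F n.
Proof.
have [phi [psi [[phid _] [psid _] psiphi _]]] := compare I E F.
apply: (@Ass_classes_sub _ _ _ _ _ _ (phi n)) => z Cz.
  exact: cocycle_map.
split=> [|Bz]; first exact: cobound_map.
apply: cobound_sub (cobound_subC (psiphi n z Cz)) _.
exact: cobound_map.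
Qed.

(** If a z dies under [g] for some a outside the prime [P], then a z comes from [A] and still has
    annihilator [P]; otherwise the image of z under [g] has annihilator [P]. *)
Lemma Ass_classes_middle A B C (EA : inj_resolution A) (EB : inj_resolution B)
    (EC : inj_resolution C) n k l (f : {linear res_mod EA n -> res_mod EB k})
    (g : {linear res_mod EB k -> res_mod EC l}) :
  (forall z, cocycle I z -> cobound I z <-> cobound I (f z)) ->
  (forall z, cocycle I z -> cocycle I (g z)) ->
  (forall z, cobound I z -> cobound I (g z)) ->
  (forall z, cocycle I z -> cobound I (g z) ->
     exists2 w, cocycle I w & cobound I (z - f w)) ->
  Ass_classes EB k `<=` Ass_classes EA n `|` Ass_classes EC l.
Proof.
move=> fB gC gB ex P [z [Cz PE Pp]].
have [[a [Pa ga]]|noa] := pselect (exists a, ~ P a /\ cobound I (g (a *: z))).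
  have [w Cw zw] := ex _ (cocycleZ a Cz) ga.
  left; exists w; split=> // b; rewrite fB ?linearZ_LR; last exact: cocycleZ.
  have zwb : cobound I (b *: (a *: z) - b *: f w).
    by rewrite -scalerBr; exact: coboundZ.
  have Pab : P b <-> P (b * a).
    split; last by case/(proj2 Pp).
    by move=> /PE Bb; apply/PE; rewrite mulrC -scalerA; exact: coboundZ.
  rewrite Pab PE -scalerA; split=> H.
    exact: cobound_sub (cobound_subC zwb) H.
  exact: cobound_sub zwb H.
right; exists (g z); split=> //; first exact: gC.
move=> a; rewrite -linearZ_LR PE; split=> [|ga]; first exact: gB.
by apply/PE; apply: contrapT => Pa; apply: noa; exists a.
Qed.

End AssociatedPrimes.

Lemma submodB (R : comNzRingType) (M : lmodType R) (N : submodClosed M) x y :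
  x \in N -> y \in N -> x - y \in N.
Proof. by move=> Nx Ny; rewrite -scaleN1r; apply/rpredD/rpredZ. Qed.

Lemma pair_ext (S T : Type) (x y : S * T) : x.1 = y.1 -> x.2 = y.2 -> x = y.
Proof. by case: x y => [a b] [c d] /= -> ->. Qed.

(** * The long exact sequence *)

Section LongExactSequence.
Context {R : comNzRingType}.
Variables A B C : lmodType R.
Variables (f : {linear A -> B}) (g : {linear B -> C}).
Hypothesis f_inj : injective f.
Hypothesis g_surj : forall c, exists b, g b = c.
Hypothesis fg_exact : forall b, g b = 0 <-> exists a, f a = b.
Variables (EA : inj_resolution A) (EC : inj_resolution C).

(* A map [theta : EC -> EA[1]] representing the class of the extension. *)
Lemma connecting_map : exists (eps : {linear B -> res_mod EA 0})
    (theta : forall n, {linear res_mod EC n -> res_mod EA n.+1}),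
  [/\ forall a, eps (f a) = res_aug EA a,
      forall b, theta 0%N (res_aug EC (g b)) = - res_d EA 0 (eps b) &
      forall n c, theta n.+1 (res_d EC n c) = - res_d EA n.+1 (theta n c)].
Proof.
have [|eps epsE] := @injective_extend _ _ _ _ f (res_aug EA)
    (@res_injective _ _ EA 0).
  by move=> a; rewrite -(linear0 f) => /f_inj ->; rewrite linear0.
have [|kap kapE] := @injective_extend _ _ _ _ g (\- (res_d EA 0 \o eps))
    (@res_injective _ _ EA 1).
  by move=> b /fg_exact[a <-] /=; rewrite epsE res_d_aug oppr0.
have [n x||theta [theta0 thetad]] := @comparison _ C EC (fun n => res_mod EA n.+1)
    (fun n => \- (res_d EA n.+1)) (fun n => @res_injective _ _ EA n.+1) _ kap.
- by rewrite /= linearN opprK res_dd.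
- by move=> c; have [b <-] := g_surj c; rewrite /= kapE /= linearN opprK res_dd.
by exists eps, theta; split=> // b; rewrite theta0 kapE.
Qed.

Section Horseshoe.
Variables (eps : {linear B -> res_mod EA 0}).
Variable theta : forall n, {linear res_mod EC n -> res_mod EA n.+1}.
Hypothesis eps_f : forall a, eps (f a) = res_aug EA a.
Hypothesis theta0 :
  forall b, theta 0%N (res_aug EC (g b)) = - res_d EA 0 (eps b).
Hypothesis thetaS :
  forall n c, theta n.+1 (res_d EC n c) = - res_d EA n.+1 (theta n c).

Definition hs_mod n : lmodType R := (res_mod EA n * res_mod EC n)%type.

Definition hs_aug_fun b : hs_mod 0 := (eps b, res_aug EC (g b)).

Lemma hs_aug_linear : linear hs_aug_fun.
Proof. by move=> r x y; rewrite /hs_aug_fun !linearP. Qed.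

Definition hs_aug : {linear B -> hs_mod 0} := mk_linear hs_aug_linear.

(** The differential of the horseshoe resolution: [theta] is its off-diagonal entry, and the sign in
    [thetaS] makes the square zero. *)
Definition hs_d_fun n (x : hs_mod n) : hs_mod n.+1 :=
  (res_d EA n x.1 + theta n x.2, res_d EC n x.2).

Lemma hs_d_linear n : linear (@hs_d_fun n).
Proof.
move=> r x y; apply: pair_ext; rewrite /= !linearP //.
by rewrite scalerDr addrACA.
Qed.

Definition hs_d n : {linear hs_mod n -> hs_mod n.+1} := mk_linear (@hs_d_linear n).

Lemma hs_injective n : injective_module (hs_mod n).
Proof. by apply: injective_prod; exact: res_injective. Qed.

Lemma hs_aug_inj : injective hs_aug.
Proof.
move=> x y [exy /(@res_aug_inj _ _ EC) gxy].
have /fg_exact[a fa] : g (x - y) = 0 by rewrite linearB gxy subrr.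
have : res_aug EA a = res_aug EA 0 by rewrite -eps_f fa linearB exy subrr linear0.
move/(@res_aug_inj _ _ EA) => a0; apply/eqP.
by rewrite -subr_eq0 -fa a0 linear0.
Qed.

Lemma hs_exact0 : range hs_aug = [set x | hs_d 0 x = 0].
Proof.
apply/seteqP; split=> [_ [b _ <-]|[a c] [/= dac /res_lift_aug[c' cE]]].
  by rewrite /= /hs_d_fun /= theta0 subrr res_d_aug.
have [b bc'] := g_surj c'; move: dac; rewrite -cE -bc' theta0 -linearB.
move=> /res_lift_aug[a' aE]; exists (b + f a') => //=.
have gfa : g (f a') = 0 by apply/fg_exact; exists a'.
apply: pair_ext => /=; last by rewrite linearD gfa addr0 bc'.
by rewrite linearD eps_f aE addrC subrK.
Qed.

Lemma hs_exactS n : range (hs_d n) = [set x | hs_d n.+1 x = 0].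
Proof.
apply/seteqP; split=> [_ [[a c] _ <-]|[a c] [/= dac /res_lift_d[c' cE]]].
  by rewrite /= /hs_d_fun /= linearD !res_dd add0r thetaS addrN.
move: dac; rewrite -cE thetaS -linearB => /res_lift_d[a' aE].
by exists (a', c') => //=; rewrite /hs_d_fun /= aE subrK.
Qed.

Definition horseshoe : inj_resolution B :=
  InjResolution hs_injective hs_aug_inj hs_exact0 hs_exactS.

End Horseshoe.

Variable I : ideal R.

(** The connecting map is [theta], defined on all cochains and not only on classes; exactness is
    read off from the two components of an element of [EB]. *)
Lemma long_exact_sequence : exists (EB : inj_resolution B)
    (i : forall n, {linear res_mod EA n -> res_mod EB n})
    (p : forall n, {linear res_mod EB n -> res_mod EC n})
    (delta : forall n, {linear res_mod EC n -> res_mod EA n.+1}),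
  [/\ lifts f i, lifts g p,
      forall n z, cocycle I z -> cocycle I (delta n z) &
      forall n z, cobound I z -> cobound I (delta n z)] /\
  [/\ forall z, cobound I (i 0%N z) -> cobound I z,
      forall n z, cocycle I z -> cobound I (i n.+1 z) ->
        exists2 w, cocycle I w & cobound I (z - delta n w),
      forall n z, cocycle I z -> cobound I (delta n z) ->
        exists2 w, cocycle I w & p n w = z &
      forall n z, cocycle I z -> cobound I (p n z) ->
        exists2 w, cocycle I w & cobound I (z - i n w)].
Proof.
have [eps [theta [eps_f theta0 thetaS]]] := connecting_map.
pose EB := horseshoe eps_f theta0 thetaS.
have i_lin n : linear (fun a : res_mod EA n => (a, 0) : res_mod EB n).
  by move=> r x y; apply: pair_ext; rewrite /= ?scaler0 ?addr0.
have j_lin n : linear (fun c : res_mod EC n => (0, c) : res_mod EB n).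
  by move=> r x y; apply: pair_ext; rewrite /= ?scaler0 ?addr0.
have p_lin n : linear (fun x : res_mod EB n => x.2 : res_mod EC n) by [].
have q_lin n : linear (fun x : res_mod EB n => x.1 : res_mod EA n) by [].
pose i n := mk_linear (@i_lin n); pose j n := mk_linear (@j_lin n).
pose p n := mk_linear (@p_lin n); pose q n := mk_linear (@q_lin n).
have dE n (x : res_mod EB n) : res_d EB n x =
  (res_d EA n x.1 + theta n x.2, res_d EC n x.2) by [].
exists EB, i, p, theta; split; split.
- split=> [n x|x]; first by rewrite dE /= !linear0 addr0.
  have gf : g (f x) = 0 by apply/fg_exact; exists x.
  by apply: pair_ext => /=; [rewrite eps_f | rewrite gf linear0].
- by [].
- move=> n z [Tz dz]; split; first exact: torsion_linear.
  by apply/eqP; rewrite -oppr_eq0 -thetaS dz linear0.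
- case=> [|n] z; first by move=> z0; rewrite (z0 : z = 0) linear0; exact: cobound0.
  move=> [w Tw <-]; exists (- theta n w); last by rewrite linearN thetaS.
  by rewrite -scaleN1r; apply/rpredZ/torsion_linear.
- by move=> z [].
- move=> n z Cz [x Tx]; rewrite dE => -[dx1 dx2].
  exists x.2; first by split=> //; exact: (torsion_linear (p n)).
  exists x.1; first exact: (torsion_linear (q n)).
  by rewrite -dx1 addrK.
- move=> n z [Tz dz] [w Tw dw].
  (* By [dw], [theta n z] is the differential of [w], so the pair (-w, z) is a cocycle above z. *)
  exists (j n z - i n w); last by rewrite /= subr0.
  split; first by apply: submodB; exact: torsion_linear.
  rewrite linearB !dE /= dz dw !linear0 addr0 add0r.
  by apply: pair_ext; rewrite subrr.
move=> n z [Tz]; rewrite dE => -[dz1 dz2]; case: n z Tz dz1 dz2 => [|n] z Tz dz1 dz2.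
  move=> /= z2; exists (q 0%N z).
    split; first exact: torsion_linear.
    by move: dz1; rewrite z2 linear0 addr0.
  rewrite /= [z in z - _]surjective_pairing z2; exact: subrr.
(* Subtracting the differential of (0, c) removes the second component of z. *)
move=> [c Tc dc]; exists (q n.+1 z - theta n c).
  split; first by apply: submodB; exact: torsion_linear.
  by rewrite linearB -[_ (theta n c)]opprK -thetaS dc opprK.
exists (j n c); first exact: torsion_linear.
rewrite dE /= linear0 add0r dc [z in z - _]surjective_pairing.
by apply: pair_ext; rewrite /= ?subr0 // opprB addrC subrK.
Qed.

End LongExactSequence.

(** * Baer's criterion and torsion submodules *)

Section Baer.
Context {R : comNzRingType}.

(** Partial linear maps are kept as graphs, so that Zorn's lemma can take unions of them. *)
Definition graph (B T : lmodType R) (G : set (B * T)) : Prop :=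
  [/\ G (0, 0), forall b t b' t', G (b, t) -> G (b', t') -> G (b + b', t + t'),
      forall a b t, G (b, t) -> G (a *: b, a *: t) & forall t, G (0, t) -> t = 0].

Lemma opprDACA (V : zmodType) (a b c d : V) : a + b - (c + d) = (a - c) + (b - d).
Proof. by rewrite opprD addrACA. Qed.

Lemma graph_sub (B T : lmodType R) (G : set (B * T)) b t b' t' :
  graph G -> G (b, t) -> G (b', t') -> G (b - b', t - t').
Proof.
move=> [_ GD GZ _] Gbt Gbt'; rewrite -scaleN1r -[- t']scaleN1r.
by apply: GD => //; exact: GZ.
Qed.

Lemma graph_fun (B T : lmodType R) (G : set (B * T)) b t t' :
  graph G -> G (b, t) -> G (b, t') -> t = t'.
Proof.
move=> hG Gt Gt'; apply/eqP; rewrite -subr_eq0; apply/eqP.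
case: (hG) => _ _ _; apply; rewrite -(subrr b); exact: graph_sub.
Qed.

Lemma graph_domain (B T : lmodType R) (G : set (B * T)) : graph G ->
  exists N : submodClosed B, forall b, (b \in N) <-> exists t, G (b, t).
Proof.
move=> [G0 GD GZ _].
have N0 : exists t, G (0, t) by exists 0.
have ND x y : (exists t, G (x, t)) -> (exists t, G (y, t)) -> exists t, G (x + y, t).
  by move=> [t Gt] [t' Gt']; exists (t + t'); exact: GD.
have NZ a x : (exists t, G (x, t)) -> exists t, G (a *: x, t).
  by move=> [t Gt]; exists (a *: t); exact: GZ.
exists (mk_submod (P := [set b | exists t, G (b, t)]) N0 ND NZ) => b.
by split=> [/mk_submodP|H]; last exact/mk_submodP.
Qed.

(** Baer's condition relative to a subset [T] of [E]: torsion requirements can be imposed one at a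
    time before passing to a submodule. *)
Definition baer (E : lmodType R) (T : set E) : Prop :=
  forall H : set (R^o * E), graph H -> (forall r e, H (r, e) -> T e) ->
  exists2 t, T t & forall (r : R) e, H (r, e) -> e = r *: t.

Lemma injective_baer (E : lmodType R) : injective_module E -> baer (@setT E).
Proof.
move=> Einj H hH _; have [N NE] := graph_domain hH.
have val_ex (b : submod N) : exists e, H (val b, e) by apply/NE; exact: valP.
pose g b := projT1 (cid (val_ex b)).
have gE b : H (val b, g b) := projT2 (cid (val_ex b)).
have g_lin : linear g.
  move=> a x y; apply: (graph_fun hH (gE _)); rewrite linearP.
  by case: (hH) => _ HD HZ _; apply: HD; [apply: HZ|]; exact: gE.
have [h hE] := Einj _ _ (val : {linear submod N -> R^o}) (mk_linear g_lin) val_inj.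
exists (h (1 : R^o)) => // r e Hre.
have rN : (r : R^o) \in N by apply/NE; exists e.
have hr := hE (exist _ (r : R^o) rN).
rewrite -linearZ_LR; have -> : r *: (1 : R^o) = r by exact: mulr1.
by apply: etrans (esym hr); exact: (graph_fun hH Hre (gE (exist _ (r : R^o) rN))).
Qed.

(** Baer's criterion: for a maximal partial extension [K], the condition applied to the multiples of
    [b] in the domain of [K] provides a value at [b]. *)
Lemma baer_injective (E : lmodType R) : baer (@setT E) -> injective_module E.
Proof.
move=> EB A B f g f_inj.
pose G : set (B * E) := [set u | exists a, u = (f a, g a)].
have hG : graph G.
  split; first by exists 0; rewrite !linear0.
  - by move=> _ _ _ _ [x [-> ->]] [y [-> ->]]; exists (x + y); rewrite !linearD.
  - by move=> a _ _ [x [-> ->]]; exists (a *: x); rewrite !linearZ_LR.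
  move=> t [a [/esym fa ->]].
  by rewrite (f_inj a 0) ?linear0.
(* Only the part added to [G] varies, so that the empty union coming from an empty chain is
   admissible. *)
pose P : set (set (B * E)) := [set H | graph (G `|` H)].
have [H [PH Hmax]] : exists H, P H /\ forall H', H `<` H' -> ~ P H'.
  apply: Zorn_bigcup => F FP totF; rewrite /P /=.
  have [[H0 FH0]|F0] := pselect (exists H, F H); last first.
    suff -> : \bigcup_(X in F) X = set0 by rewrite setU0.
    by rewrite -subset0 => x [X FX]; case: F0; exists X.
  have cov x : (G `|` \bigcup_(X in F) X) x -> exists2 X, F X & (G `|` X) x.
    by case=> [Gx|[X FX Xx]]; [exists H0 | exists X] => //; [left|right].
  have sub X x : F X -> (G `|` X) x -> (G `|` \bigcup_(X in F) X) x.
    by move=> FX [Gx|Xx]; [left | right; exists X].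
  split; first by left; case: hG.
  - move=> b t b' t' /cov[X FX Xx] /cov[Y FY Yy].
    have [Z FZ [Zx Zy]] : exists2 Z, F Z & (G `|` Z) (b, t) /\ (G `|` Z) (b', t').
      have [XY|YX] := totF X Y FX FY.
        by exists Y => //; split=> //; case: Xx; [left|move=> /XY; right].
      by exists X => //; split=> //; case: Yy; [left|move=> /YX; right].
    by have [_ ZD _ _] := FP _ FZ; apply: (sub Z) => //; exact: ZD.
  - move=> a b t /cov[X FX Xx]; apply: (sub X) => //.
    by have [_ _ XZ _] := FP _ FX; exact: XZ.
  by move=> t /cov[X FX Xt]; have [_ _ _] := FP _ FX; exact.
pose K := G `|` H; have hK : graph K := PH.
have totK b : exists t, K (b, t).
  pose L : set (R^o * E) := [set u | K ((u.1 : R) *: b, u.2)].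
  have [K0 KD KZ Kf] := hK.
  have hL : graph L.
    split; rewrite /L /=; first by rewrite scale0r.
    - by move=> r t r' t' Kr Kr'; rewrite scalerDl; exact: KD.
    - by move=> a r t Kr; rewrite -scalerA; exact: KZ.
    by move=> t; rewrite scale0r; exact: Kf.
  have [//|t0 _ t0E] := EB L hL.
  pose K' : set (B * E) := [set u | exists r : R, K (u.1 - r *: b, u.2 - r *: t0)].
  have KK' : K `<=` K'.
    by move=> [c t] Kc; exists 0; rewrite /= !scale0r !subr0.
  have hK' : graph K'.
    split; first exact: KK'.
    - move=> c t c' t' [r /= Kr] [r' /= Kr']; exists (r + r') => /=.
      by rewrite !scalerDl !opprDACA; exact: KD.
    - move=> a c t [r /= Kr]; exists (a * r) => /=.
      by rewrite -!scalerA -!scalerBr; exact: KZ.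
    move=> t [r /=]; rewrite sub0r -scaleNr => Kr.
    have /eqP := t0E (- r) _ Kr.
    by rewrite scaleNr -subr_eq0 opprK subrK => /eqP.
  have K'K : K' `<=` K.
    apply: contrapT => nK'K; apply: (Hmax K').
      split; first by move=> x Hx; apply: KK'; right.
      by move=> K'H; apply: nK'K => x /K'H; right.
    rewrite /P /= (_ : G `|` K' = K') //; apply/seteqP; split=> x; last by right.
    by case=> // Gx; apply: KK'; left.
  by exists t0; apply: K'K; exists 1; rewrite /= !scale1r !subrr.
pose h b := projT1 (cid (totK b)).
have hE b : K (b, h b) := projT2 (cid (totK b)).
have h_lin : linear h.
  move=> a x y; apply: (graph_fun hK (hE _)).
  by case: (hK) => _ KD KZ _; apply: KD; [apply: KZ|]; exact: hE.
exists (mk_linear h_lin) => a; apply: (graph_fun hK (hE _)).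
by left; exists a.
Qed.

Lemma baer_submod (E : lmodType R) (N : submodClosed E) :
  baer [set e | e \in N] -> injective_module (submod N).
Proof.
move=> NB; apply: baer_injective => H [H0 HD HZ Hf] _.
pose H' : set (R^o * E) := [set u | exists n, H (u.1, n) /\ u.2 = val n].
have hH' : graph H'.
  split; first by exists 0.
  - move=> r _ r' _ [n [/= Hn ->]] [n' [/= Hn' ->]]; exists (n + n').
    by split; [exact: HD|].
  - move=> a r _ [n [/= Hn ->]]; exists (a *: n).
    by split; [exact: HZ | rewrite linearZ_LR].
  by move=> t [n [/= /Hf n0 ->]]; rewrite n0.
have [|t Nt tE] := NB H' hH'; first by move=> r _ [n [_ /= ->]]; exact: valP.
exists (exist _ t Nt) => // r n Hrn; apply: val_inj; rewrite linearZ_LR /=.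
by apply: tE; exists n.
Qed.

Hypothesis R_noeth : noetherian R.

(* With [(K : x^m)] stable from [m0] on and [x^n] killing the values of a
   partial map defined on [K], that map extends by zero to [K + (x^(m0 + n))]. *)
Lemma baer_power_torsion (E : lmodType R) (T : set E) (x : R) : T 0 -> baer T ->
  baer [set e | T e /\ exists n, x ^+ n *: e = 0].
Proof.
move=> T0 TB H hH HT; have [H0 HD HZ Hf] := hH.
have [K KE] := graph_domain hH.
have [n xn] : exists n, forall r e, H (r, e) -> x ^+ n *: e = 0.
  have [l [lK Kl]] := noetherian_gens R_noeth K.
  have [n ln] : exists n, forall r, r \in l -> exists2 e, H (r, e) & x ^+ n *: e = 0.
    elim: l lK {Kl} => [|r l IH] lK; first by exists 0%N.
    have [y ly|n ln] := IH; first by apply: lK; rewrite inE ly orbT.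
    have /KE[e He] := lK r (mem_head _ _).
    have [_ [k ek]] := HT _ _ He.
    exists (k + n)%N => r'; rewrite inE => /predU1P[->|/ln[e' He' e'n]].
      by exists e => //; rewrite exprD mulrC -scalerA ek scaler0.
    by exists e' => //; rewrite exprD -scalerA e'n scaler0.
  have [|||D DE] := @ideal_of_set R [set r : R | exists2 e, H (r, e) & x ^+ n *: e = 0].
  - by exists 0 => //; rewrite scaler0.
  - move=> r r' [e He en] [e' He' en']; exists (e + e'); first exact: HD.
    by rewrite scalerDr en en' addr0.
  - move=> a r [e He en]; exists (a *: e); first exact: HZ.
    by rewrite scalerA mulrC -scalerA en scaler0.
  exists n => r e Hre.
  have /DE[e' He' e'n] : r \in D.
    apply: (@adds_min R zero_ideal l D).
    - by move=> _ /zero_idealP ->; exact: ideal0.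
    - by move=> y /ln ?; apply/DE.
    - by apply: Kl; apply/KE; exists e.
  by rewrite (graph_fun hH Hre He').
have colon k : exists D : ideal R, forall a, (a \in D) <-> x ^+ k * a \in K.
  apply: ideal_of_set; first by rewrite mulr0; exact: ideal0.
    by move=> a b Ka Kb; rewrite mulrDr; exact: idealD.
  by move=> a b Kb; rewrite mulrCA; exact: idealM.
pose D k := projT1 (cid (colon k)).
have DE k a : (a \in D k) <-> x ^+ k * a \in K := projT2 (cid (colon k)) a.
have Dinc k : {subset D k <= D k.+1}.
  by move=> a /DE Ka; apply/DE; rewrite exprS -mulrA; exact: idealM.
have [m0 Dm0] := ascending_stationary R_noeth Dinc.
have stab k a : x ^+ (m0 + k) * a \in K -> x ^+ m0 * a \in K.
  elim: k a => [|k IH] a; first by rewrite addn0.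
  rewrite addnS exprSr -mulrA => /IH; rewrite mulrA -exprSr.
  by move=> /DE/Dm0/DE.
pose m := (m0 + n)%N.
pose H' : set (R^o * E) :=
  [set u | exists r a : R, u.1 = r + a * x ^+ m /\ H (r, u.2)].
have hH' : graph H'.
  split; first by exists 0, 0; rewrite mul0r addr0.
  - move=> _ t _ t' [r [a [/= -> Hr]]] [r' [a' [/= -> Hr']]].
    exists (r + r'), (a + a'); split; last exact: HD.
    by rewrite mulrDl addrACA.
  - move=> b _ t [r [a [/= -> Hr]]]; exists (b * r), (b * a).
    by split; [rewrite -mulrA -mulrDr | exact: HZ].
  (* Well-definedness: if r + a x^m = 0, then x^m0 a is in [K] by stability, and the value at r is
     -x^n times the value at x^m0 a, hence zero. *)
  move=> t [r [a [/= /esym/eqP ra Hr]]].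
  have rE : r = - (a * x ^+ m) by apply/eqP; rewrite -addr_eq0.
  have Kx : x ^+ m * a \in K.
    apply/KE; exists (- t); rewrite -[- t]scaleN1r.
    have -> : x ^+ m * a = (-1) * r by rewrite rE; ring.
    exact: HZ.
  have /KE[t' Ht'] := stab _ _ Kx.
  have Ht'' := HZ (- x ^+ n) _ _ Ht'.
  have rE' : r = - x ^+ n *: (x ^+ m0 * a : R^o).
    by rewrite rE /m exprD -[_ *: _]/(- x ^+ n * (x ^+ m0 * a)); ring.
  rewrite rE' in Hr; rewrite (graph_fun hH Hr Ht'') scaleNr (xn _ _ Ht').
  by rewrite oppr0.
have [|t Tt tE] := TB H' hH'; first by move=> r e [r' [a [_ /HT[]]]].
exists t; last by move=> r e He; apply: tE; exists r, 0; rewrite mul0r addr0.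
split=> //; exists m; symmetry; apply: tE; exists 0, 1.
by rewrite add0r mul1r.
Qed.

Lemma baer_powers_torsion (E : lmodType R) (l : seq R) : injective_module E ->
  baer [set e : E | forall x, x \in l -> exists n, x ^+ n *: e = 0].
Proof.
move=> Einj; elim: l => [|x l IH].
  have -> : [set e : E | forall x, x \in [::] -> exists n, x ^+ n *: e = 0] = setT.
    by apply/seteqP.
  exact: injective_baer.
have -> : [set e : E | forall y, y \in x :: l -> exists n, y ^+ n *: e = 0] =
    [set e : E | [set e | forall y, y \in l -> exists n, y ^+ n *: e = 0] e /\
       exists n, x ^+ n *: e = 0].
  apply/seteqP; split=> e /= H.
    split; last by apply: H; exact: mem_head.
    by move=> y ly; apply: H; rewrite inE ly orbT.
  by case: H => [H Hx] y; rewrite inE => /predU1P[->//|/H].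
apply: baer_power_torsion => // y _; exists 0%N; exact: scaler0.
Qed.

End Baer.

(** * Torsion with respect to an ideal *)

Section TorsionModules.
Context {R : comNzRingType}.

(** By linearity the first factor may be taken to be a generator [y]. Replacing [e] by y e lowers
    the exponent of [y], and there are more factors than the sum of the exponents. *)
Lemma prod_kills (M : lmodType R) (l : seq R) (e : M) (n : R -> nat) N :
  (\sum_(x <- l) n x < N)%N -> (forall x, x \in l -> x ^+ n x *: e = 0) ->
  forall F : 'I_N -> R, (forall j, F j \in gen_seq l) -> (\prod_j F j) *: e = 0.
Proof.
elim: N e n => [//|N IH] e n nN ne F FI.
rewrite big_ord_recl mulrC -scalerA; set p := \prod_(i < N) _.
have [|||D DE] := @ideal_of_set R [set r : R | p *: (r *: e) = 0].
- by rewrite /= scale0r scaler0.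
- by move=> r r' /= re re'; rewrite scalerDl scalerDr re re' addr0.
- move=> a r /= re.
  by rewrite -(scalerA a r e) (scalerA p a) (mulrC p a) -(scalerA a p) re scaler0.
suff : F ord0 \in D by move=> /DE.
apply: (gen_min _ (FI ord0)) => y /= ly; apply/DE => /=.
have [ny|ny] := posnP (n y).
  by have := ne y ly; rewrite ny expr0 scale1r => ->; rewrite !scaler0.
apply: (IH _ (fun z => if z == y then (n z).-1 else n z)) => //.
- rewrite ltnS in nN; apply: leq_trans nN.
  elim: l ly {ne FI IH D DE} => // z l IHl; rewrite inE => /predU1P[<-|ly].
    rewrite !big_cons eqxx -[in X in (_ < X)%N](prednK ny) addSn ltnS leq_add2l.
    by apply: leq_sum => w _; case: eqP => // _; exact: leq_pred.
  rewrite !big_cons -addnS; apply: leq_add; last exact: IHl.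
  by case: eqP => // _; exact: leq_pred.
move=> x lx; case: eqP => [->|_]; last by rewrite scalerA mulrC -scalerA ne ?scaler0.
by rewrite scalerA -exprSr prednK // ne.
Qed.

Lemma torsion_power (I : ideal R) (M : lmodType R) (e : M) x :
  e \in torsion I M -> x \in I -> exists n, x ^+ n *: e = 0.
Proof.
move=> /torsionP[n en] Ix; exists n; apply: en; apply: mem_gen.
by exists (fun=> x) => //; rewrite prodr_const card_ord.
Qed.

Lemma torsion_gens (I : ideal R) (l : seq R) (M : lmodType R) (e : M) :
  I =i gen_seq l ->
  (e \in torsion I M) <-> (forall x, x \in l -> exists n, x ^+ n *: e = 0).
Proof.
move=> Il; split=> [Te x lx|H].
  by apply: torsion_power Te _; rewrite Il; exact: mem_gen.
have /choice[n nE] : forall x, exists n, x \in l -> x ^+ n *: e = 0.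
  move=> x; have [/H[n xn]|nl] := pselect (x \in l); first by exists n.
  by exists 0%N => /nl.
apply/torsionP; exists (\sum_(x <- l) n x).+1 => r Ir.
apply/mem_ann; apply: (gen_min _ Ir) => _ [F FI ->]; apply/mem_ann.
by apply: prod_kills (ltnSn _) nE _ _ => j; rewrite -Il.
Qed.

(** Torsion amounts to being killed by a power of each of finitely many generators, and Baer's
    condition survives these requirements one by one. *)
Lemma injective_Gamma (I : ideal R) (E : lmodType R) : noetherian R ->
  injective_module E -> injective_module (Gamma I E).
Proof.
move=> R_noeth Einj; have [l Il] := R_noeth I.
apply: baer_submod.
suff -> : [set e | e \in torsion I E] =
    [set e | forall x, x \in l -> exists n, x ^+ n *: e = 0].
  exact: baer_powers_torsion.
by apply/seteqP; split=> e /(torsion_gens e Il).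
Qed.

(* The identity of a torsion module lifts to a chain map of an injective
   resolution [E] factoring through [Gamma I E], which consists of injectives. *)
Lemma vanishes_torsion (I : ideal R) (N : lmodType R) n : noetherian R ->
  (forall e, e \in torsion I N) -> vanishes I N n.+1.
Proof.
move=> R_noeth TN; have E : inj_resolution N := std_resolution N.
have aT e : res_aug E e \in torsion I (res_mod E 0) by exact: torsion_linear.
have a_lin : linear (fun e => exist _ (res_aug E e) (aT e) : Gamma I (res_mod E 0)).
  by move=> a x y; apply: val_inj; rewrite /= !linearP.
have [k|k x|x|phi [phi0 phid]] := @comparison R N E (fun k => Gamma I (res_mod E k))
  (fun k => Gamma_map I (res_d E k)) _ _ (mk_linear a_lin).
- by apply: injective_Gamma => //; exact: res_injective.
- by apply: val_inj; exact: res_dd.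
- by apply: val_inj; exact: res_d_aug.
pose psi k : {linear res_mod E k -> res_mod E k} :=
  (val : {linear Gamma I (res_mod E k) -> res_mod E k}) \o phi k.
have psiL : lifts idfun psi.
  by split=> [k x|x]; rewrite /psi /= ?phid ?phi0.
apply: (vanishes_by (E := E)) => z Cz; have [Tz dz] := Cz.
have psiz : cobound I (psi n.+1 z - z).
  rewrite -[X in _ - X]scale1r.
  exact: (lifts_unique psiL (@lifts_scale _ _ E 1 idfun (fun x => esym (scale1r x))) Cz).
apply: cobound_sub (cobound_subC psiz) _.
(* The cochain [w] may fail to be torsion, but [psi n w] is torsion because [psi] factors through
   [Gamma I E]. *)
have [w wz] := res_lift_d dz; exists (psi n w); first exact: valP.
by rewrite -(proj1 psiL) wz.
Qed.

End TorsionModules.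

(** * Vanishing and divisibility of local cohomology *)

Section Multiplication.
Context {R : comNzRingType}.
Variables (I : ideal R) (x : R) (M C : lmodType R) (g : {linear M -> C}).
Hypothesis x_inj : forall y : M, x *: y = 0 -> y = 0.
Hypothesis g_surj : forall c, exists b, g b = c.
Hypothesis g_ker : forall b, g b = 0 <-> exists a, x *: a = b.

Let xmap : {linear M -> M} := x \*: (idfun : {linear M -> M}).

Lemma mul_exact_sequence (E : inj_resolution M) :
  exists (EC : inj_resolution C) (EB : inj_resolution M)
    (i : forall n, {linear res_mod E n -> res_mod EB n})
    (p : forall n, {linear res_mod EB n -> res_mod EC n})
    (delta : forall n, {linear res_mod EC n -> res_mod E n.+1}),
  [/\ lifts xmap i, lifts g p,
      forall n z, cocycle I z -> cocycle I (delta n z) &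
      forall n z, cobound I z -> cobound I (delta n z)] /\
  [/\ forall z, cobound I (i 0%N z) -> cobound I z,
      forall n z, cocycle I z -> cobound I (i n.+1 z) ->
        exists2 w, cocycle I w & cobound I (z - delta n w),
      forall n z, cocycle I z -> cobound I (delta n z) ->
        exists2 w, cocycle I w & p n w = z &
      forall n z, cocycle I z -> cobound I (p n z) ->
        exists2 w, cocycle I w & cobound I (z - i n w)].
Proof.
exists (std_resolution C); apply: long_exact_sequence => //.
move=> a b /= xab; apply/eqP; rewrite -subr_eq0; apply/eqP/x_inj.
by rewrite scalerBr; apply/eqP; rewrite subr_eq0; apply/eqP.
Qed.

(** Multiplication by [x] is injective on H^n(M), its kernel coming from degree n - 1 of [C] and
    being zero for [n = 0], while every class is killed by a power of [x]. *)
Lemma vanishes_mul n : x \in I -> (forall k, n = k.+1 -> vanishes I C k) ->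
  vanishes I M n.
Proof.
move=> Ix CV E z Cz.
have [EC [EB [i [p [delta [[iL pL dC dB] [ex0 ex1 _ _]]]]]]] := mul_exact_sequence E.
have [chi [psi [[chid chi0] psiL _ chipsi]]] := compare I E EB.
have xB (y : res_mod E n) : cocycle I y -> cobound I (x *: y) -> cobound I y.
  move=> Cy xy.
  have Ciy : cocycle I (i n y) by apply: cocycle_map Cy; case: iL.
  (* [E] and [EB] resolve the same module; followed by [psi], the lift [i] agrees with
     multiplication by [x] up to coboundaries. *)
  have psii : cobound I (psi n (i n y)).
    have H := lifts_unique (lifts_comp iL psiL) (@lifts_scale _ _ E x _ (fun=> erefl)) Cy.
    exact: cobound_sub H xy.
  have iB : cobound I (i n y).
    apply: cobound_sub (cobound_subC (chipsi n _ Ciy)) _.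
    exact: cobound_map.
  case: n CV y Cy iB {z Cz xy Ciy psii} => [|k] CV y Cy iB; first exact: ex0.
  have [w Cw yw] := ex1 k y Cy iB; apply: cobound_sub yw _.
  by apply/dB/CV.
have [k xk] := torsion_power (proj1 Cz) Ix.
elim: k z Cz xk => [|k IH] z Cz xk.
  by rewrite -(scale1r z) -(expr0 x) xk; exact: cobound0.
apply: xB => //; apply: IH; first exact: cocycleZ.
by rewrite scalerA -exprSr.
Qed.

Lemma divisible_mul (E : inj_resolution M) n (z : res_mod E n) : vanishes I C n ->
  cocycle I z -> exists2 y, cocycle I y & cobound I (z - x *: y).
Proof.
move=> CV Cz.
have [EC [EB [i [p [delta [[iL [pd _] _ _] [_ _ _ ex3]]]]]]] := mul_exact_sequence E.
have [chi [psi [[chid chi0] psiL psichi _]]] := compare I E EB.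
have Cchi : cocycle I (chi n z) by exact: cocycle_map.
have [|y Cy zy] := ex3 n _ Cchi; first by apply: CV; exact: cocycle_map.
exists y => //.
apply: cobound_trans (cobound_subC (psichi n z Cz)) _.
have H := lifts_unique (lifts_comp iL psiL) (@lifts_scale _ _ E x _ (fun=> erefl)) Cy.
apply: cobound_trans H.
by rewrite -linearB; apply: cobound_map => //; case: psiL.
Qed.

End Multiplication.

(** * Cyclic modules and ideals generated by parameters *)

Section Cyclic.
Context {R : comNzRingType}.

(** This is R/K up to isomorphism; keeping the presentation lets M/xM be presented from R in the
    same way, with kernel [adj K x]. *)
Definition cyclic_by (K : ideal R) (M : lmodType R) (p : {linear R^o -> M}) :=
  (forall y, exists r, p r = y) /\ forall r : R, p r = 0 <-> r \in K.

Lemma cyclic_mul (K : ideal R) (M : lmodType R) (p : {linear R^o -> M}) (x : R) :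
  prime_ideal K -> x \notin K -> cyclic_by K p ->
  exists (C : lmodType R) (g : {linear M -> C}),
  [/\ forall y : M, x *: y = 0 -> y = 0, forall c, exists b, g b = c,
      forall b, g b = 0 <-> exists a, x *: a = b & cyclic_by (adj K x) (g \o p)].
Proof.
move=> [K1 KM] Kx [p_surj pK].
pose D := im (x \*: (idfun : {linear M -> M})).
have gE b : quotmod_pi D b = 0 <-> exists a, x *: a = b.
  rewrite -(linear0 (quotmod_pi D)).
  have := quotmod_pi_eq D b 0; rewrite subr0 => ->.
  split=> [/mk_submodP[a _ <-]|[a xa]]; first by exists a.
  by apply/mk_submodP; exists a.
have pM a r : p (a * r : R) = a *: p r by rewrite -linearZ_LR.
exists (quotmod D : lmodType R), (quotmod_pi D); split=> //.
- move=> y; have [r <-] := p_surj y; rewrite -pM => /pK/KM[Kx'|/pK//].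
  by rewrite Kx' in Kx.
- exact: quotmod_pi_surj.
split=> [c|r].
  have [b <-] := quotmod_pi_surj c; have [r <-] := p_surj b.
  by exists r.
split=> [/gE[a]|/adjP[k Kk [a ->]]].
  have [s <-] := p_surj a; rewrite -pM => /eqP; rewrite eq_sym -subr_eq0 -linearB.
  move=> /eqP/pK Krs; apply/adjP; exists (r - x * s) => //.
  by exists s; ring.
apply/gE; exists (p a); rewrite -pM linearD (proj2 (pK k) Kk) add0r.
by rewrite mulrC.
Qed.

Variables (m : ideal R).
Hypotheses (R_noeth : noetherian R) (m_local : local_ring m).

(** Induction on the generators [u] that [I] has beyond [K]. With none left, M is R/I, which [I]
    kills; each generator shifts the degree by one through [vanishes_mul]. *)
Lemma vanishes_params (I K : ideal R) (u v : seq R) (M : lmodType R)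
    (p : {linear R^o -> M}) n :
  params m K (u ++ v) -> I =i adds K u -> cyclic_by K p -> n <> size u ->
  vanishes I M n.
Proof.
elim: u K M p n => [|x u IH] K M p n.
  case: n => [//|n] _ IK [p_surj pK] _; apply: vanishes_torsion => // y.
  have [r <-] := p_surj y; apply/torsionP; exists 1%N => a I1a.
  have Ia : a \in I.
    apply: (gen_min _ I1a) => _ [f fI ->]; rewrite big_ord1; exact: fI.
  rewrite -linearZ_LR; apply/pK; rewrite -[_ *: _]/(a * r) mulrC.
  by apply: idealM; rewrite -[K]/(adds K [::]) -IK.
move=> Kuv Ixu pK nu.
have [C [g [x_inj g_surj g_ker gpK]]] :=
  cyclic_mul (params_prime R_noeth m_local Kuv) (params_notin R_noeth m_local Kuv) pK.
apply: (vanishes_mul x_inj g_surj g_ker).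
  by rewrite Ixu; apply: adds_mem; exact: mem_head.
move=> k nk; apply: (IH (adj K x) _ (g \o p)) => //.
  exact: (params_adj R_noeth m_local Kuv).
by move=> ku; apply: nu; rewrite nk ku.
Qed.

Lemma cohomology_divisible (I : ideal R) (u v l : seq R) y
    (E : inj_resolution R^o) n (z : res_mod E n) :
  params m zero_ideal (u ++ v) -> I =i adds zero_ideal u ->
  params m zero_ideal (y :: l) -> y \in I -> cocycle I z ->
  exists2 w, cocycle I w & cobound I (z - y *: w).
Proof.
move=> uv Iu yl Iy Cz.
have pid : cyclic_by zero_ideal (idfun : {linear R^o -> R^o}).
  split=> [r|r]; first by exists r.
  by split=> /zero_idealP.
(* Outside degree [size u] every class of R is zero, so zero serves as the quotient by [y]. *)
have [nu|nu] := eqVneq n (size u); last first.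
  exists 0; rewrite ?scaler0 ?subr0; first exact: cocycle0.
  by apply: (vanishes_params uv Iu pid) Cz => /eqP; rewrite (negPf nu).
have um : {subset u <= m}.
  by move=> w uw; rewrite (proj1 uv); apply: adds_mem; rewrite mem_cat uw.
(* Trading [x] for [y] leaves [size u - 1] generators of [I] beyond [y], so the cohomology of R/(y)
   vanishes in degree [size u]. *)
have [u1 [x [u2 [uE xu]]]] := exchange_params R_noeth m_local yl um
  (etrans (esym (Iu y)) Iy).
have Iu' : adds zero_ideal u =i adds zero_ideal (y :: u1 ++ u2).
  move=> w; apply/idP/idP; apply: adds_min.
  - by move=> a a0; exact: adds_sub.
  - move=> a; rewrite uE mem_cat inE => au.
    have [->//|ax] := eqVneq a x; apply: adds_mem.
    by move: au; rewrite (negPf ax) inE mem_cat => ->; rewrite orbT.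
  - by move=> a a0; exact: adds_sub.
  move=> a; rewrite inE => /predU1P[->|au]; first by rewrite -Iu.
  apply: adds_mem; rewrite uE; move: au; rewrite !mem_cat inE.
  by case/orP=> ->; rewrite ?orbT.
have yuv : params m zero_ideal ((y :: u1 ++ u2) ++ v).
  apply: params_gens uv; first by rewrite uE /= !size_cat /= addnS.
  move=> w; apply/idP/idP; apply: adds_min; do ?by move=> a a0; exact: adds_sub.
    move=> a; rewrite mem_cat => /orP[au|av]; last first.
      by apply: adds_mem; rewrite mem_cat av orbT.
    have : a \in adds zero_ideal (y :: u1 ++ u2) by rewrite -Iu'; exact: adds_mem.
    by apply: adds_eq => // b bu; rewrite mem_cat bu.
  move=> a; rewrite mem_cat => /orP[au|av]; last first.
    by apply: adds_mem; rewrite mem_cat av orbT.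
  have : a \in adds zero_ideal u by rewrite Iu'; exact: adds_mem.
  by apply: adds_eq => // b bu; rewrite mem_cat bu.
have [C [g [y_inj g_surj g_ker gp]]] := cyclic_mul
  (params_prime R_noeth m_local yl) (params_notin R_noeth m_local yl) pid.
apply: (divisible_mul y_inj g_surj g_ker) Cz.
apply: (vanishes_params (params_adj R_noeth m_local yuv) _ gp).
  by move=> w; rewrite Iu Iu'.
by rewrite nu uE !size_cat /= addnS => /eqP; rewrite eqn_leq ltnn.
Qed.

End Cyclic.

(** * Transfer of finiteness between [J] and R/J *)

Lemma rsop_part_split (R : comNzRingType) (m I : ideal R) :
  noetherian R -> local_ring m -> gen_by_part_of_rsop m I ->
  exists u v, params m zero_ideal (u ++ v) /\ I =i adds zero_ideal u.
Proof.
move=> R_noeth m_local [s [t [/rsop_params ms ts It]]].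
(* Filtering [s] discards any repetitions in [t], so that the two lists together are a permutation
   of [s]. *)
exists [seq x <- s | x \in t], [seq x <- s | x \notin t]; split.
  by apply: params_perm ms; rewrite perm_sym; apply/permPl/perm_filterC.
move=> x; rewrite It gen_seqE; apply/idP/idP; apply: adds_eq => // y.
  by move=> ty; rewrite mem_filter ty ts.
by rewrite mem_filter => /andP[].
Qed.

Theorem theorem1p5 (R : comNzRingType) (m I J : ideal R)
  (R_regular : regular_local_ring m)
  (R_LC : LC_finite R)
  (JI : {subset J <= I})
  (d : nat) (J_depth : depth_in J d) (d_ge2 : (2 <= d)%N)
  (I_gen : gen_by_part_of_rsop m I)
  (J_gen : gen_by_part_of_rsop m J)
  (i : nat) (i_ge1 : (1 <= i)%N) :
  finite_set (Ass (local_cohomology I i (submod J))) <->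
  finite_set (Ass (local_cohomology I i.-1 (quotmod J))).
Proof.
have [R_noeth m_local _] := R_regular.
case: i i_ge1 => // n _.
have [u [v [uv Iu]]] := rsop_part_split R_noeth m_local I_gen.
have [[|y u'] [v' [yl Ju]]] := rsop_part_split R_noeth m_local J_gen.
  (* Without generators [J] is zero, and a regular sequence in it would begin with 0; as 0 times 1
     is in the zero ideal, 1 would be too. *)
  have [s [[s1 sreg] sJ _] sd] := J_depth; case/negP: s1.
  have s_gt0 : (0 < size s)%N by rewrite sd (leq_trans _ d_ge2).
  have s0 : s`_0 = 0.
    apply/zero_idealP; rewrite -[zero_ideal]/(adds zero_ideal [::]) -Ju.
    exact/sJ/mem_nth.
  have := sreg 0%N 1 s_gt0; rewrite s0 mul0r take0 => /(_ (ideal0 _)).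
  by rewrite !gen_seqE; apply: adds_eq.
have Jy : y \in J by rewrite Ju; apply: adds_mem; exact: mem_head.
have f_inj : injective (val : {linear submod J -> R^o}) by exact: val_inj.
have g_surj := @quotmod_pi_surj R R^o J.
have fg b : quotmod_pi J b = 0 <-> exists a : submod J, val a = b.
  rewrite -(linear0 (quotmod_pi J)).
  have := quotmod_pi_eq J b 0; rewrite subr0 => ->.
  split=> [Jb|[a <-]]; last exact: valP.
  by exists (exist _ b Jb).
rewrite /local_cohomology !Ass_derived_Gamma [n.+1.-1]/=.
move: (std_resolution (submod J)) (std_resolution (quotmod J)) => EA EC.
have [EB [i [p [delta [[iL pL dC dB] [ex0 ex1 ex2 ex3]]]]]] :=
  long_exact_sequence f_inj g_surj fg EA EC I.
(* Multiplication by [y] on [EC] lifts the zero map of R/J, since [y] is in [J]. *)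
have yEC (c : res_mod EC n) : cocycle I c -> cobound I (y *: c).
  apply: (cobound_null
    (phi := fun k => y \*: (idfun : {linear res_mod EC k -> res_mod EC k}))).
    by move=> k z; rewrite /= linearZ_LR.
  move=> q; rewrite /= -linearZ_LR; have [r <-] := g_surj q.
  have -> : y *: quotmod_pi J r = 0; last exact: linear0.
  have Jyr : (y *: r : R^o) \in J by rewrite -[_ *: _]/(y * r) mulrC; exact: idealM.
  by rewrite -linearZ_LR; apply/fg; exists (exist (fun x => x \in J) _ Jyr).
(* Up to coboundaries a class of R is a multiple of [y], and [y] kills the classes of R/J. *)
have p0 (b : res_mod EB n) : cocycle I b -> cobound I (p n b).
  move=> Cb; have [w Cw bw] := cohomology_divisible R_noeth m_local uv Iu yl (JI y Jy) Cb.
  have := cobound_map (proj1 pL) bw; rewrite linearB linearZ_LR => /cobound_sub; apply.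
  by apply: yEC; apply: cocycle_map Cw; case: pL.
(* By exactness the kernel of [delta n] on classes is the image of [p n], which is zero. *)
have deltaB c : cocycle I c -> cobound I c <-> cobound I (delta n c).
  move=> Cc; split; first exact: dB.
  by move=> /(ex2 _ _ Cc)[w Cw <-]; exact: p0.
have finB : finite_set (Ass_classes I EB n.+1).
  apply: (sub_finite_set _ (proj2 R_LC I n.+1)).
  by rewrite /local_cohomology Ass_derived_Gamma; exact: Ass_classes_indep.
split=> fin.
  apply: sub_finite_set fin; apply: (Ass_classes_sub (g := delta n)) => //.
  exact: dC.
(* The associated primes of H^(n+1)(J) come from H^n(R/J), embedded by [delta n], or from
   H^(n+1)(R). *)
apply: (@sub_finite_set _ _ (Ass_classes I EC n `|` Ass_classes I EB n.+1)); last first.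
  by rewrite finite_setU.
apply: (Ass_classes_middle (f := delta n) (g := i n.+1)) => //.
- by move=> z Cz; apply: cocycle_map Cz; case: iL.
- by move=> z Bz; apply: cobound_map Bz; case: iL.
exact: ex1.
Qed.
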